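(* For every positive integer $d$ there is a constant $C_d>0$, depending only on $d$, such that the following holds. Let $F$ be a totally real number field of degree $d=[F:\mathbb{Q}]$ and discriminant $\Delta$, with ring of integers $\mathcal{O}_F$. Then there is a universal quadratic form over $\mathcal{O}_F$ whose rank (number of variables) is less than $C_d\,\Delta(\log\Delta)^{d-1}$.
   Context: An element $\alpha\in F$ is totally positive if $\sigma(\alpha)>0$ for every embedding $\sigma:F\hookrightarrow\mathbb{R}$; write $\mathcal{O}_F^+$ for the set of totally positive elements of $\mathcal{O}_F$. A quadratic form $Q:\mathcal{O}_F^r\to\mathcal{O}_F$ of rank $r$ is totally positive definite if $Q(v)$ is totally positive for all nonzero $v\in F^r$. A universal quadratic form over $\mathcal{O}_F$ is a totally positive definite quadratic form $Q:\mathcal{O}_F^r\to\mathcal{O}_F$ that represents every element of $\mathcal{O}_F^+$, i.e., for every $\alpha\in\mathcal{O}_F^+$ there is $v\in\mathcal{O}_F^r$ with $Q(v)=\alpha$. When $d=1$ the factor $(\log\Delta)^{d-1}$ is read as $1$. *)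

(* Defs.v *)
From mathcomp Require Import all_boot all_order all_algebra all_field.
From mathcomp Require Import complex.
From mathcomp Require Import reals exp.

Set Implicit Arguments.
Unset Strict Implicit.
Unset Printing Implicit Defensive.

Import Order.TTheory GRing.Theory Num.Theory.

Local Open Scope ring_scope.

(* Number fields are the finite extensions [F : fieldExtType rat], with        *)
(* [F:Q] = \dim {:F}; the real and complex numbers are R and R[i], for an      *)
(* arbitrary R : realType.                                                     *)

Definition is_integer (F : fieldExtType rat) (x : F) : Prop :=
  integralOver (intr : int -> F) x.

Definition totally_real (R : realType) (F : fieldExtType rat) : Prop :=
  forall (s : {rmorphism F -> R[i]}) (x : F), s x \is Num.real.

Definition totally_positive (R : realType) (F : fieldExtType rat) (x : F) :
    Prop :=
  forall s : {rmorphism F -> R}, 0 < s x.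

Definition field_trace (F : fieldExtType rat) (x : F) : rat :=
  let e := vbasis {:F} in \tr (passmx.mxof e e (amull x)).

Definition integral_basis (F : fieldExtType rat) (n : nat) (b : n.-tuple F) :
    Prop :=
  (forall i : 'I_n, is_integer (tnth b i)) /\
  (forall x : F, is_integer x ->
     exists! c : {ffun 'I_n -> int}, x = \sum_(i < n) tnth b i *~ c i).

(* D is independent of the choice of the integral basis, whose size is         *)
(* necessarily \dim {:F}.                                                      *)
Definition is_discriminant (F : fieldExtType rat) (D : int) : Prop :=
  exists2 b : (\dim {:F}).-tuple F, integral_basis b &
    \det (\matrix_(i, j) field_trace (tnth b i * tnth b j)) = D%:~R.

(* Only the entries a i j with i <= j are used: cross terms a i j * x_i * x_j  *)
(* need not have coefficients divisible by 2.                                  *)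
Definition quadratic_form (F : fieldExtType rat) (r : nat) (a : 'M[F]_r)
    (v : 'rV[F]_r) : F :=
  \sum_(i < r) \sum_(j < r | (i <= j)%N) a i j * v 0 i * v 0 j.

Definition integral_form (F : fieldExtType rat) (r : nat) (a : 'M[F]_r) : Prop :=
  forall i j : 'I_r, (i <= j)%N -> is_integer (a i j).

Definition totally_positive_definite (R : realType) (F : fieldExtType rat)
    (r : nat) (a : 'M[F]_r) : Prop :=
  forall v : 'rV[F]_r, v != 0 -> totally_positive R (quadratic_form a v).

Definition universal_form (R : realType) (F : fieldExtType rat) (r : nat)
    (a : 'M[F]_r) : Prop :=
  [/\ integral_form a, totally_positive_definite R a &
      forall x : F, is_integer x -> totally_positive R x ->
        exists2 v : 'rV[F]_r, (forall i : 'I_r, is_integer (v 0 i)) &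
          quadratic_form a v = x].

(* Main.v *)
Require Import Defs.
From HB Require Import structures.
From mathcomp Require Import all_boot all_order all_algebra all_field.
From mathcomp Require Import complex.
From mathcomp Require Import reals exp.
From mathcomp Require Import boolp zify ring lra.

(** Write O for the ring of integers, U for the group of totally positive units,
    N for the absolute norm, D for the discriminant, and put
    X = (d+1)^d * D. The universal form is diagonal: its coefficients are
    representatives, modulo squares of U, of the totally positive integers of
    norm at most X, each of them repeated 4 * 2^d times.

    Why it is universal. Among the ways to write a totally positive integer alpha
    as a sum of totally positive integers, take one with the largest number of
    summands and, among those, with the least total trace of the squares of the
    summands ([decomposition]). If some summand h had norm at least X, geometry of
    numbers would give a nonzero integer x with x^2 < h at every real place
    ([square_below]), and h = x^2 + (h - x^2) would add a summand. If two distinct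
    summands h and k were congruent modulo 2, replacing both by (h + k) / 2 would
    decrease the trace of squares. Hence all summands have norm below X, and at
    most 2^d of them are distinct: alpha = sum_k n_k h_k over k <= 2^d. Each n_k is
    a sum of four squares, and each h_k is a representative times the square of a
    unit, so alpha is represented.

    Why the rank is small. Localizing O at a rational prime p gives a principal
    ideal ring with at most d primes. This is proved by hand: the partial Horner
    sums of an integral relation satisfied by s = x / y show that, at each prime
    above p, s or 1 / s is integral ([local_dichotomy]); combined with idempotents
    of the finite ring O / p this gives Bezout relations ([local_bezout]). So the
    p-part of a nonzero integer is described, up to local units, by d exponents,
    and an integer up to units by d positive natural numbers of product at most
    its norm ([ideal_labels]). There are at most X (1 + ln X)^(d-1) such tuples
    of product at most X ([card_tuples_le]). Inside one class modulo units, at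
    most 2^d classes modulo squares of U occur: from 2^d + 1 of them one could
    build (2^d + 1)^k units of logarithmic height O(2^k), whereas a lattice of
    rank at most d has only O(2^(d k)) of them ([unit_square_classes]).

    This gives a rank O(X (1 + ln X)^(d-1)), which is O(D (ln D)^(d-1)) as soon as
    ln D is bounded away from 0. For d >= 2 this is the theorem D > 1 of
    Hermite and Minkowski ([disc_neq1]), obtained from the same geometry of numbers
    applied to the trace form. *)

Set Implicit Arguments.
Unset Strict Implicit.
Unset Printing Implicit Defensive.

Import Order.TTheory GRing.Theory Num.Theory.

Local Open Scope ring_scope.

(** * Sums of four squares *)

Definition sum4sq (x : int) : Prop :=
  exists a b c e : int, x = a ^+ 2 + b ^+ 2 + c ^+ 2 + e ^+ 2.

Lemma sum4sqM x y : sum4sq x -> sum4sq y -> sum4sq (x * y).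
Proof.
move=> [a [b [c [e ->]]]] [a' [b' [c' [e' ->]]]].
exists (a * a' + b * b' + c * c' + e * e'), (a * b' - b * a' + c * e' - e * c').
exists (a * c' - c * a' + e * b' - b * e'), (a * e' - e * a' + b * c' - c * b').
by ring.
Qed.

Lemma centered_residue (m : nat) (x : int) : (0 < m)%N ->
  exists2 y : int, (exists q, x = y + q * m%:Z) & 2 * `|y| <= m%:Z.
Proof.
move=> m0.
have Em := divz_eq x m%:Z.
have r0 : 0 <= (x %% m%:Z)%Z by apply: modz_ge0; lia.
have rm : (x %% m%:Z)%Z < m%:Z by have := ltz_mod x (d := m%:Z); lia.
case: (leP (2 * (x %% m%:Z)%Z) m%:Z) => h.
  exists (x %% m%:Z)%Z; last by lia.
  by exists (x %/ m%:Z)%Z; rewrite addrC.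
exists ((x %% m%:Z)%Z - m%:Z); last by lia.
by exists ((x %/ m%:Z)%Z + 1); rewrite {1}Em; ring.
Qed.

Lemma sq_le_centered (m : nat) (y : int) : 2 * `|y| <= m%:Z ->
  4 * y ^+ 2 <= m%:Z ^+ 2.
Proof.
move=> h; have := ler_pM _ _ h h; rewrite -!expr2 exprMn real_normK ?num_real //.
by apply; rewrite ?mulr_ge0.
Qed.

(** Reduce the four terms to centered residues modulo m: their squares sum to
    some m r with r <= m, and the product of the two sums, divided by m^2, is r
    p. If r = 0 or r = m, all residues are 0 or all are +-m/2, and in both cases
    m^2 divides m p, which is impossible for 1 < m < p. *)
Lemma sum4sq_descent (p m : nat) : prime p -> (1 < m < p)%N ->
  sum4sq (m * p)%N%:Z -> exists2 r : nat, (0 < r < m)%N & sum4sq (r * p)%N%:Z.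
Proof.
move=> pp /andP[m1 mp] [a [b [c [e E]]]].
have m0 : (0 < m)%N by lia.
have [a' [qa Ea] ha] := centered_residue a m0.
have [b' [qb Eb] hb] := centered_residue b m0.
have [c' [qc Ec] hc] := centered_residue c m0.
have [e' [qe Ee] he] := centered_residue e m0.
have ha2 := sq_le_centered ha; have hb2 := sq_le_centered hb.
have hc2 := sq_le_centered hc; have he2 := sq_le_centered he.
have [r Er] : exists r : int,
    a' ^+ 2 + b' ^+ 2 + c' ^+ 2 + e' ^+ 2 = m%:Z * r.
  exists (p%:Z - (2 * a' * qa + qa ^+ 2 * m%:Z + 2 * b' * qb + qb ^+ 2 * m%:Z +
     2 * c' * qc + qc ^+ 2 * m%:Z + 2 * e' * qe + qe ^+ 2 * m%:Z)).
  rewrite mulrBr -PoszM E Ea Eb Ec Ee; ring.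
have mZ : (0 < m%:Z :> int) by lia.
have sq0 (z : int) : 0 <= z ^+ 2 by apply: sqr_ge0.
have r_ge0 : 0 <= r.
  by rewrite -(pmulr_rge0 _ mZ) -Er !addr_ge0.
have r_lem : r <= m%:Z.
  rewrite -(ler_pM2l mZ) -Er -expr2.
  by move: ha2 hb2 hc2 he2; lra.
have pm_ndvd : ~ exists q : int, p%:Z = q * m%:Z.
  move=> [q Eq].
  have dv : (m %| p)%N.
    by apply/dvdnP; exists `|q|%N; rewrite -[p]/(`|p%:Z|%N) Eq abszM.
  by have /primeP[_ /(_ m dv) /orP[] /eqP em] := pp; move: m1 mp; rewrite em ltnn.
have r_neq0 : r != 0.
  apply/eqP=> r0; rewrite r0 mulr0 in Er.
  have z4 (u v w z : int) : u ^+ 2 + v ^+ 2 + w ^+ 2 + z ^+ 2 = 0 -> u = 0.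
    move=> H; apply/eqP; rewrite -sqrf_eq0; apply/eqP.
    by move: (sq0 u) (sq0 v) (sq0 w) (sq0 z) H; lra.
  have a0 := z4 _ _ _ _ Er.
  have b0 : b' = 0 by apply: (z4 b' a' c' e'); rewrite -Er; ring.
  have c0 : c' = 0 by apply: (z4 c' a' b' e'); rewrite -Er; ring.
  have e0 : e' = 0 by apply: (z4 e' a' b' c'); rewrite -Er; ring.
  apply: pm_ndvd; exists (qa ^+ 2 + qb ^+ 2 + qc ^+ 2 + qe ^+ 2).
  apply: (mulfI (lt0r_neq0 mZ)); rewrite -PoszM E Ea Eb Ec Ee a0 b0 c0 e0; ring.
have r_ltm : r < m%:Z.
  rewrite lt_neqAle r_lem andbT; apply/eqP=> rm; rewrite rm -expr2 in Er.
  have [Ea' Eb' Ec' Ee'] : [/\ 4 * a' ^+ 2 = m%:Z ^+ 2, 4 * b' ^+ 2 = m%:Z ^+ 2,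
      4 * c' ^+ 2 = m%:Z ^+ 2 & 4 * e' ^+ 2 = m%:Z ^+ 2].
    by move: Er ha2 hb2 hc2 he2; split; lra.
  have sgn u : 2 * `|u| <= m%:Z -> 4 * u ^+ 2 = m%:Z ^+ 2 ->
      2 * u = m%:Z \/ 2 * u = - m%:Z.
    move=> hu Eu; have : (2 * u - m%:Z) * (2 * u + m%:Z) = 0.
      have -> : (2 * u - m%:Z) * (2 * u + m%:Z) = 4 * u ^+ 2 - m%:Z ^+ 2 by ring.
      by rewrite Eu subrr.
    by move/eqP; rewrite mulf_eq0 => /orP[] /eqP; clear; lia.
  have key u q : 2 * u = m%:Z \/ 2 * u = - m%:Z ->
      exists t : int, (u + q * m%:Z) ^+ 2 = u ^+ 2 + t * m%:Z ^+ 2.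
    move=> [h|h].
      exists (q + q ^+ 2).
      have -> : (u + q * m%:Z) ^+ 2 = u ^+ 2 + 2 * u * q * m%:Z + q ^+ 2 * m%:Z ^+ 2 by
        ring.
      by rewrite h; ring.
    exists (- q + q ^+ 2).
    have -> : (u + q * m%:Z) ^+ 2 = u ^+ 2 + 2 * u * q * m%:Z + q ^+ 2 * m%:Z ^+ 2 by ring.
    by rewrite h; ring.
  have [ta Ta] := key a' qa (sgn _ ha Ea'); have [tb Tb] := key b' qb (sgn _ hb Eb').
  have [tc Tc] := key c' qc (sgn _ hc Ec'); have [te Te] := key e' qe (sgn _ he Ee').
  apply: pm_ndvd; exists (1 + ta + tb + tc + te).
  apply: (mulfI (lt0r_neq0 mZ)); rewrite -PoszM E Ea Eb Ec Ee Ta Tb Tc Te.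
  have -> : a' ^+ 2 + ta * m%:Z ^+ 2 + (b' ^+ 2 + tb * m%:Z ^+ 2) +
      (c' ^+ 2 + tc * m%:Z ^+ 2) + (e' ^+ 2 + te * m%:Z ^+ 2) =
      (a' ^+ 2 + b' ^+ 2 + c' ^+ 2 + e' ^+ 2) + (ta + tb + tc + te) * m%:Z ^+ 2 by ring.
  by rewrite Er; ring.
have [n En] : exists n : nat, r = n%:Z by exists `|r|%N; move: r_ge0; clear; lia.
exists n; first by move: r_neq0 r_ltm; rewrite En; clear; lia.
(* Euler's identity for (m p) (m r), with the common factor m^2 removed. *)
exists (r + a' * qa + b' * qb + c' * qc + e' * qe).
exists (qa * b' - qb * a' + qc * e' - qe * c').
exists (qa * c' - qc * a' + qe * b' - qb * e').
exists (qa * e' - qe * a' + qb * c' - qc * b').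
have m2 : m%:Z ^+ 2 != 0 by rewrite expf_neq0 // lt0r_neq0.
apply: (mulfI m2).
have -> : m%:Z ^+ 2 * (n * p)%N%:Z = (m * p)%N%:Z * (m%:Z * r) by rewrite En !PoszM; ring.
rewrite E -Er.
have -> : m%:Z ^+ 2 * ((r + a' * qa + b' * qb + c' * qc + e' * qe) ^+ 2 +
   (qa * b' - qb * a' + qc * e' - qe * c') ^+ 2 +
   (qa * c' - qc * a' + qe * b' - qb * e') ^+ 2 +
   (qa * e' - qe * a' + qb * c' - qc * b') ^+ 2) =
   (m%:Z * r + m%:Z * (a' * qa + b' * qb + c' * qc + e' * qe)) ^+ 2 +
   m%:Z ^+ 2 * ((qa * b' - qb * a' + qc * e' - qe * c') ^+ 2 +
   (qa * c' - qc * a' + qe * b' - qb * e') ^+ 2 +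
   (qa * e' - qe * a' + qb * c' - qc * b') ^+ 2) by ring.
rewrite -Er Ea Eb Ec Ee; ring.
Qed.

(** With h = (p - 1) / 2, the h + 1 squares x^2 and the h + 1 numbers -(y^2 +
    1), for x and y in [0, h], cannot all be distinct modulo p, while squaring
    is injective modulo p on [0, h]. *)
Lemma dvd_sum2sq_succ (p : nat) : prime p -> odd p ->
  exists x y m : nat, [/\ (0 < m < p)%N & (m * p = x ^ 2 + y ^ 2 + 1)%N].
Proof.
move=> pp po; set h := (p.-1./2)%N.
have p1 := prime_gt1 pp.
have Ep : p = h.*2.+1 by rewrite /h; lia.
have sq_inj (x y : nat) : (x <= h)%N -> (y <= h)%N -> x ^ 2 = y ^ 2 %[mod p] -> x = y.
  wlog xy : x y / (x <= y)%N.
    move=> W hx hy E; case: (leqP x y) => [|/ltnW] xy; first exact: W.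
    by symmetry; apply: W.
  move=> hx hy /esym/eqP; rewrite eqn_mod_dvd ?leq_exp2r // subn_sqr Euclid_dvdM //.
  case: (ltngtP x y) xy => // xy _ /orP[] /dvdn_leq H.
    by have := H ltac:(lia); lia.
  by have := H ltac:(lia); lia.
have p0 : (0 < p)%N by lia.
pose f (s : 'I_h.+1 + 'I_h.+1) : 'I_p :=
  match s with
  | inl x => Ordinal (ltn_pmod (x ^ 2) p0)
  | inr y => Ordinal (ltn_pmod (p * p - (y ^ 2 + 1)) p0)
  end.
have : ~~ injectiveb f.
  apply/negP=> /injectiveP /leq_card; rewrite card_sum !card_ord; lia.
case/injectivePn=> s [t neq] E.
have small (y : 'I_h.+1) : (y ^ 2 + 1 < p * p)%N.
  have := ltn_ord y; have -> : (y ^ 2 = y * y)%N by []. nia.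
have fin (x y : 'I_h.+1) : f (inl x) = f (inr y) ->
    exists x y m : nat, [/\ (0 < m < p)%N & (m * p = x ^ 2 + y ^ 2 + 1)%N].
  move/(congr1 val) => /= Exy.
  have dv : (p %| x ^ 2 + (y ^ 2 + 1))%N.
    rewrite /dvdn -modnDml Exy modnDml subnK ?modnMl //; exact: ltnW.
  case/dvdnP: dv => m Em; exists x, y, m; split; last by rewrite -Em addnA.
  have hx : (x ^ 2 <= h * h)%N by rewrite -mulnn leq_mul // -ltnS.
  have hy : (y ^ 2 <= h * h)%N by rewrite -mulnn leq_mul // -ltnS.
  apply/andP; split; first by case: m Em => //; rewrite mul0n addn1 addnS.
  rewrite -(ltn_pmul2r p0) -Em; move: hx hy p1; rewrite Ep;
    move: (x ^ 2)%N (y ^ 2)%N => u v; clear; nia.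
case: s t neq E => [x|x] [y|y] neq E.
- case/negP: neq; apply/eqP; congr inl; apply: val_inj => /=.
  by apply: sq_inj; [rewrite -ltnS|rewrite -ltnS|exact: (congr1 val E)].
- exact: fin E.
- exact: fin (esym E).
- case/negP: neq; apply/eqP; congr inr; apply: val_inj => /=.
  apply: sq_inj; [by rewrite -ltnS|by rewrite -ltnS|].
  move/(congr1 val): E => /= E.
  have sx := small x; have sy := small y.
  set u := (p * p - (x ^ 2 + 1))%N in E; set v := (p * p - (y ^ 2 + 1))%N in E.
  have Ex : (x ^ 2 + (1 + u) = p * p)%N by rewrite addnA subnKC // ltnW.
  have Ey : (y ^ 2 + (1 + v) = p * p)%N by rewrite addnA subnKC // ltnW.
  apply/eqP; rewrite -(eqn_modDr (1 + u)) Ex -Ey; apply/eqP.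
  by rewrite !addnA -modnDmr -E modnDmr.
Qed.

Lemma sum4sq_prime (p : nat) : prime p -> sum4sq p%:Z.
Proof.
move=> pp; case: (boolP (odd p)) => [po|/prime_oddPn]; last first.
  by move=> /(_ pp) ->; exists 1, 1, 0, 0.
have [x [y [m [Hm Em]]]] := dvd_sum2sq_succ pp po.
have : sum4sq (m * p)%N%:Z.
  by exists x%:Z, y%:Z, 1, 0; rewrite Em -!mulnn !PoszD !PoszM !expr2 mulr0 addr0.
clear x y Em; elim/ltn_ind: m Hm => m IH /andP[m0 mp] Hm.
case: (leqP m 1) => m1.
  have Em : m = 1%N by lia.
  by rewrite Em mul1n in Hm; apply: Hm.
have [r /andP[r0 rm] Hr] := sum4sq_descent pp (introT andP (conj m1 mp)) Hm.
by apply: IH Hr => //; rewrite r0 (ltn_trans rm mp).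
Qed.

(** Lagrange's theorem. *)
Theorem sum4sq_nat (n : nat) : sum4sq n%:Z.
Proof.
elim/ltn_ind: n => n IH.
case: (leqP n 1) => n1.
  case: n n1 {IH} => [|[|n]] // _; first by exists 0, 0, 0, 0.
  by exists 1, 0, 0, 0.
have pp := pdiv_prime n1; have /dvdnP[q Eq] := pdiv_dvd n.
rewrite {1}Eq PoszM; apply: sum4sqM; last exact: sum4sq_prime.
apply: IH; have := prime_gt1 pp; move: Eq; set p := pdiv n => Eq p1.
by rewrite {1}Eq ltn_Pmulr //; case: q Eq => //; lia.
Qed.

(** * Short vectors of rational quadratic forms *)

(** Gram-Schmidt: split off the first coordinate and apply induction to the
    Schur complement, which is again positive definite. *)
Lemma ldl_decomposition (K : realFieldType) (n : nat) (G : 'M[K]_n) :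
  G^T = G -> (forall v : 'rV_n, v != 0 -> 0 < (v *m G *m v^T) 0 0) ->
  exists (U : 'M[K]_n) (D : 'rV[K]_n),
    [/\ is_trig_mx U, forall i, U i i = 1, forall i, 0 < D 0 i &
        G = U *m diag_mx D *m U^T].
Proof.
elim: n G => [|n IH] G Gsym Gpos.
  exists 0, 0; split; [|by case|by case|].
    by apply/is_trig_mxP=> -[].
  by apply/matrixP=> -[].
rewrite -[n.+1]/(1 + n)%N in G Gsym Gpos *.
set a := G 0 0; set h := ursubmx G; set H := drsubmx G.
have Eul : ulsubmx G = a%:M.
  by rewrite [ulsubmx G]mx11_scalar; congr (_%:M); rewrite !mxE; congr (G _ _);
    apply: val_inj.
have Edl : dlsubmx G = h^T by rewrite trmx_ursub Gsym.
have EG : G = block_mx a%:M h h^T H by rewrite -Eul -Edl submxK.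
have Hsym : H^T = H by rewrite /H trmx_drsub Gsym.
have Gval (u : 'M_1) (v : 'rV_n) : row_mx u v *m G *m (row_mx u v)^T =
    (u *m a%:M + v *m h^T) *m u^T + (u *m h + v *m H) *m v^T.
  by rewrite EG mul_row_block tr_row_mx mul_row_col.
have a0 : 0 < a.
  have := Gpos (row_mx 1%:M 0); rewrite Gval mul0mx addr0 trmx0 mulmx0 addr0 trmx1 mulmx1
    mul1mx mxE eqxx.
  by apply; apply/eqP=> /(congr1 lsubmx)/matrixP/(_ 0 0)/eqP;
    rewrite row_mxKl linear0 !mxE eqxx oner_eq0.
pose S := H - a^-1 *: (h^T *m h).
have [||U [D [Ut U1 D0 ES]]] := IH S.
- by rewrite /S linearB linearZ /= trmx_mul trmxK Hsym.
- move=> v v0.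
  have := Gpos (row_mx (- (a^-1 *: (v *m h^T))) v).
  rewrite Gval mul_mx_scalar scalerN scalerA divff ?lt0r_neq0 // scale1r addNr mul0mx add0r.
  rewrite addrC mulmxDl !mulNmx -!scalemxAl /S mulmxBr mulmxBl -scalemxAr -!scalemxAl
    !mulmxA.
  apply; apply: contra v0 => /eqP/(congr1 rsubmx); rewrite row_mxKr linear0 => ->.
  exact: eqxx.
exists (block_mx 1%:M 0 (a^-1 *: h^T) U), (row_mx a%:M D); split.
- by rewrite is_trig_block_mx // Ut andbT; apply/andP; split; [|apply/is_trig_mxP => i j;
    rewrite !ord1 ltnn].
- move=> i; case: (split_ordP i) => j ->; first by rewrite block_mxEul !ord1 mxE eqxx.
  by rewrite block_mxEdr.
- move=> i; case: (split_ordP i) => j ->; first by rewrite row_mxEl !ord1 mxE eqxx.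
  by rewrite row_mxEr.
- rewrite {1}EG.
  have -> : diag_mx (row_mx a%:M D) = block_mx a%:M 0 0 (diag_mx D).
    rewrite diag_mx_row; congr block_mx; apply/matrixP=> i j.
    by rewrite !ord1 !mxE eqxx !mulr1n.
  rewrite (@tr_block_mx _ 1 n 1 n) linearZ /= trmxK trmx1 trmx0.
  rewrite !mulmx_block !mul1mx !mulmx0 !mul0mx !addr0 !mulmx1 ?add0r.
  rewrite mul0mx addr0 mul_scalar_mx mul_mx_scalar !scalerA mulfV ?lt0r_neq0 //.
  rewrite !scale1r -scalemxAr -ES; congr block_mx.
  by rewrite /S addrC subrK.
Qed.

(** The cube [0, k[^n meets every coset of the row lattice of a triangular
    matrix with diagonal k; this replaces the computation of the index of that
    lattice. The entry 0 is adjusted last, since the first row of A affects it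
    only. *)
Lemma triangular_reduction (n k : nat) (A : 'M[int]_n) : (0 < k)%N ->
  is_trig_mx A -> (forall i, A i i = k%:Z) ->
  forall x : 'rV[int]_n, exists c : 'rV[int]_n,
    forall i, 0 <= (x - c *m A) 0 i < k%:Z.
Proof.
move=> k0; elim: n A => [|n IH] A At Ad x; first by exists 0; case.
rewrite -[n.+1]/(1 + n)%N in A At Ad x *.
have EA : A = block_mx k%:Z%:M 0 (dlsubmx A) (drsubmx A).
  rewrite -{1}[A]submxK; congr block_mx.
    by rewrite [ulsubmx A]mx11_scalar !mxE Ad.
  by apply/matrixP=> i j; rewrite !mxE (is_trig_mxP At) //= ord1.
have [||c Hc] := IH (drsubmx A) _ _ (rsubmx x).
- by apply/is_trig_mxP=> i j ij; rewrite !mxE (is_trig_mxP At) //.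
- by move=> i; rewrite !mxE Ad.
pose y := (lsubmx x - c *m dlsubmx A) 0 0.
exists (row_mx (y %/ k%:Z)%Z%:M c) => i.
rewrite EA mul_row_block -[x]hsubmxK opp_row_mx add_row_mx mulmx0 add0r.
case: (split_ordP i) => j ->; last by rewrite row_mxEr.
rewrite row_mxEl !ord1 mul_mx_scalar opprD addrA [_ - _ - _]addrAC mxE -/y !mxE -/y.
rewrite eqxx mulr1n mulrC.
have := divz_eq y k%:Z; have := modz_ge0 y (d := k%:Z); have := ltz_mod y (d := k%:Z).
by move: (y %/ k%:Z)%Z (y %% k%:Z)%Z => q r; lia.
Qed.

(** Two points of the box with sides [0, T i] have the same reduction in [0,
    k[^n; their difference lies in the lattice. *)
Lemma thue (n k : nat) (A : 'M[int]_n) (T : 'I_n -> nat) : (0 < k)%N ->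
  is_trig_mx A -> (forall i, A i i = k%:Z) ->
  (k ^ n < \prod_(i < n) (T i).+1)%N ->
  exists2 c : 'rV[int]_n, c != 0 & forall i, `|(c *m A) 0 i| <= (T i)%:Z.
Proof.
move=> k0 At Ad kT.
have [quo Hquo] := choice (triangular_reduction k0 At Ad).
pose vec (x : {dffun forall i : 'I_n, 'I_(T i).+1}) : 'rV[int]_n := \row_i (x i : nat)%:Z.
pose r x i := (vec x - quo (vec x) *m A) 0 i.
have r_lt x i : (`|r x i| < k)%N by have := Hquo (vec x) i; rewrite -/(r x i); lia.
pose f x : {ffun 'I_n -> 'I_k} := [ffun i => Ordinal (r_lt x i)].
have : ~~ injectiveb f.
  apply/negP=> /injectiveP /leq_card; rewrite card_dep_ffun card_ffun !card_ord.
  rewrite foldrE big_map big_enum /= leqNgt => /negP[].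
  by rewrite (eq_bigr (fun i => (T i).+1)) // => i _; rewrite card_ord.
case/injectivePn=> x [y xy] Exy.
have Er : vec x - quo (vec x) *m A = vec y - quo (vec y) *m A.
  apply/rowP=> i; have /(congr1 val) := congr1 (fun g : {ffun _ -> _} => g i) Exy.
  rewrite !ffunE /= => E; rewrite -/(r x i) -/(r y i).
  have hx : 0 <= r x i < k := Hquo (vec x) i; have hy : 0 <= r y i < k := Hquo (vec y) i.
  by move: E hx hy; move: (r x i) (r y i); clear; lia.
have EA : (quo (vec x) - quo (vec y)) *m A = vec x - vec y.
  move: Er; rewrite mulmxBl.
  move: (vec x) (vec y) (quo (vec x) *m A) (quo (vec y) *m A) => u v a b Er.
  by rewrite (canRL (subrK _) Er) [RHS]addrAC [_ - _ - v]addrAC subrr add0r addrC.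
exists (quo (vec x) - quo (vec y)) => [|i].
  apply: contra xy => /eqP E0; rewrite E0 mul0mx in EA.
  apply/eqP/ffunP=> i; apply: val_inj.
  by move/rowP/(_ i): EA; rewrite !mxE /=; lia.
rewrite EA !mxE; have := ltn_ord (x i); have := ltn_ord (y i).
by move: (x i : nat) (y i : nat); lia.
Qed.

Lemma common_denominator (m n : nat) (U : 'M[rat]_(m, n)) :
  exists2 k : nat, (0 < k)%N & exists A : 'M[int]_(m, n), map_mx intr A = k%:R *: U.
Proof.
pose k := (\prod_i \prod_j `|denq (U i j)|)%N.
have k0 : (0 < k)%N.
  by apply: prodn_gt0 => i; apply: prodn_gt0 => j; rewrite absz_gt0 denq_neq0.
exists k => //.
have dv i j : exists q, (k = q * `|denq (U i j)|)%N.
  apply/dvdnP; rewrite /k (bigD1 i) //= (bigD1 j) //=.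
  by rewrite -mulnA dvdn_mulr.
exists (\matrix_(i, j) (numq (U i j) * (k %/ `|denq (U i j)|)%N%:Z)).
apply/matrixP=> i j; rewrite !mxE; have [q Eq] := dv i j.
have d0 : (0 < `|denq (U i j)|)%N by rewrite absz_gt0 denq_neq0.
rewrite {2}Eq {1}Eq mulnK // rmorphM /= numqE natrM -mulrA mulrC; congr (_ * _).
by rewrite -[denq _ in LHS]absz_denq mulrC.
Qed.

(** Minkowski's theorem for boxes, in the coordinates that diagonalize a
    positive definite form. Bounding every diagonal term separately, with free
    weights tau, is what makes the sharp case [disc_neq1] accessible: unequal
    weights of the same product exclude the equality cases. *)
Lemma short_vector (n : nat) (U : 'M[rat]_n) (D tau : 'I_n -> rat) : (0 < n)%N ->
  is_trig_mx U -> (forall i, U i i = 1) ->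
  (forall i, 0 < D i) -> (forall i, 0 < tau i) ->
  \prod_i D i <= \prod_i tau i ->
  exists2 c : 'rV[int]_n, c != 0 &
    forall i, D i * (map_mx intr c *m U) 0 i ^+ 2 <= tau i.
Proof.
move=> n0 Ut Ud D0 tau0 Dtau.
have [k k0 [A EA]] := common_denominator U.
have kQ : 0 < k%:R :> rat by rewrite ltr0n.
have [T HT] : exists T : 'I_n -> nat, forall i,
    D i * (T i)%:R ^+ 2 <= k%:R ^+ 2 * tau i < D i * (T i).+1%:R ^+ 2.
  (* The floor of k sqrt (tau i / D i), without square roots. *)
  suff H i : exists t : nat, D i * t%:R ^+ 2 <= k%:R ^+ 2 * tau i < D i * t.+1%:R ^+ 2.
    by have [T HT] := choice H; exists T.
  pose P t := D i * (t%:R : rat) ^+ 2 <= k%:R ^+ 2 * tau i.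
  have P0 : exists t, P t by exists 0%N; rewrite /P expr0n mulr0 mulr_ge0 ?sqr_ge0 // ltW.
  have x0 : 0 <= k%:R ^+ 2 * tau i / D i by rewrite mulr_ge0 ?invr_ge0 ?mulr_ge0 ?sqr_ge0
    // ltW.
  have Pm t : P t -> (t <= Num.bound (k%:R ^+ 2 * tau i / D i))%N.
    rewrite /P => Pt; rewrite -(ler_nat rat); apply: le_trans (ltW (archi_boundP x0)).
    rewrite ler_pdivlMr // mulrC; apply: le_trans Pt.
    rewrite ler_pM2l // expr2; case: t => [|t]; first by rewrite mulr0.
    by rewrite ler_peMr ?ler0n // ler1n.
  case: (ex_maxnP P0 Pm) => t Pt tmax; exists t; apply/andP; split=> //.
  by rewrite ltNge; apply/negP=> /tmax; rewrite ltnn.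
have kT : (k ^ n < \prod_(i < n) (T i).+1)%N.
  rewrite -(ltn_sqr) -(ltr_nat rat) !natrX.
  have D0' : 0 < \prod_i D i by apply: prodr_gt0.
  rewrite -(ltr_pM2l D0') -exprM mulnC exprM natr_prod -prodrXl -big_split /=.
  apply: (@le_lt_trans _ _ (\prod_i (k%:R ^+ 2 * tau i))).
    rewrite big_split /= prodr_const card_ord mulrC ler_pM2l // exprn_gt0 // exprn_gt0 //.
  apply: ltr_prod; last by move=> i _; have /andP[_ ->] := HT i;
    rewrite mulr_ge0 ?sqr_ge0 // ltW.
  by apply/hasP; exists (Ordinal n0); rewrite ?mem_index_enum.
have EAij i j : (A i j)%:~R = k%:R * U i j :> rat.
  by have /matrixP/(_ i j) := EA; rewrite !mxE.
have At : is_trig_mx A.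
  apply/is_trig_mxP=> i j ij; apply: (@intr_inj rat).
  by rewrite EAij (is_trig_mxP Ut) // mulr0.
have Ad i : A i i = k%:Z by apply: (@intr_inj rat); rewrite EAij Ud mulr1.
have [c c0 Hc] := thue k0 At Ad kT; exists c => // i.
have Ez : (map_mx intr c *m U) 0 i = ((c *m A) 0 i)%:~R / k%:R.
  apply: (canRL (mulfK (lt0r_neq0 kQ))).
  have -> : ((c *m A) 0 i)%:~R = (map_mx intr (c *m A) : 'rV[rat]_n) 0 i by rewrite
    [RHS]mxE.
  by rewrite map_mxM /= EA -scalemxAr [RHS]mxE mulrC.
have /andP[HT1 _] := HT i.
rewrite Ez exprMn exprVn mulrA ler_pdivrMr ?exprn_gt0 // [tau i * _]mulrC.
apply: le_trans HT1; rewrite ler_pM2l // -[X in X <= _]real_normK ?num_real //.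
rewrite -intr_norm; have := Hc i; rewrite -(ler_int rat) => h.
by rewrite ler_pXn2r // nnegrE ?ler0z ?ler0n.
Qed.

(** * Tuples of bounded product *)

Definition tuples_le (n X : nat) : {set {ffun 'I_n -> 'I_X.+1}} :=
  [set f : {ffun 'I_n -> 'I_X.+1} | [forall j, (0 < f j)%N] && (\prod_j f j <= X)%N].

(** The index t = 0 contributes 0^-1 = 0. The induction step is 1 / (X + 2) <=
    ln ((X + 2) / (X + 1)), which is 1 - z <= exp (- z) at z = 1 / (X + 2). *)
Lemma harmonic_le (R : realType) (X : nat) :
  \sum_(t < X.+2) (t%:R : R)^-1 <= 1 + ln X.+1%:R.
Proof.
elim: X => [|X IH].
  by rewrite !big_ord_recl big_ord0 /= ln1 addr0 invr0 invr1 add0r addr0.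
rewrite big_ord_recr /=; apply: le_trans (lerD IH (lexx _)) _.
rewrite -addrA lerD2l -lerBrDl.
set a : R := X.+1%:R; set c : R := X.+2%:R.
have a0 : 0 < a by rewrite ltr0n.
have c0 : 0 < c by rewrite ltr0n.
have Ec : c = a + 1 by rewrite /c -natr1.
rewrite -ln_div ?posrE // -[X in X <= _]opprK -[X in _ <= X]opprK lerN2.
rewrite -lnV ?posrE ?divr_gt0 // invf_div.
rewrite -[X in _ <= X]expRK ler_ln ?posrE ?divr_gt0 ?expR_gt0 //.
have -> : a / c = 1 + - c^-1.
  by rewrite -[X in X + _](mulfV (lt0r_neq0 c0)) -[X in _ - X]mul1r -mulrBl Ec addrK.
exact: expR_ge1Dx.
Qed.

Lemma tuples_le_fiber (n X : nat) (g : {ffun 'I_n -> 'I_X.+1}) :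
  (0 < \prod_j g j)%N ->
  (#|[set f in tuples_le n.+1 X | [ffun j => f (lift ord0 j)] == g]| <= X %/ \prod_j g j)%N.
Proof.
move=> P0; set S := [set _ in _ | _]; set P := (\prod_j g j)%N in P0 *; set q := (X %/ P)%N.
have SP f : f \in S -> [/\ (0 < f ord0)%N, (f ord0 <= q)%N & forall j, f (lift ord0 j) =
  g j].
  rewrite !inE => /andP[/andP[/forallP f0 fX] /eqP/ffunP Ef].
  have Ef' j : f (lift ord0 j) = g j by have := Ef j; rewrite ffunE.
  split=> //; rewrite leq_divRL //; apply: leq_trans fX.
  by rewrite big_ord_recl; under eq_bigr do rewrite Ef'.
pose phi (f : {ffun 'I_n.+1 -> 'I_X.+1}) : 'I_q.+1 := inord (f ord0).
have phi_inj : {in S &, injective phi}.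
  move=> f f' /SP[_ fq Ef] /SP[_ fq' Ef'] /(congr1 val); rewrite /= !inordK ?ltnS // => E0.
  apply/ffunP=> j; case: (unliftP ord0 j) => [i ->|->]; first by rewrite Ef Ef'.
  exact: val_inj.
rewrite -(card_in_imset phi_inj).
have Eq : #|[set~ (ord0 : 'I_q.+1)]| = q by rewrite cardsC1 card_ord.
rewrite -[X in (_ <= X)%N]Eq; apply: subset_leq_card;
  apply/subsetP=> _ /imsetP[f /SP[f0 fq _] ->].
by rewrite !inE -val_eqE /= inordK ?ltnS // -lt0n.
Qed.

(** Once the last n - 1 entries are fixed, the first one takes at most X divided
    by their product ([tuples_le_fiber]), and the sum of these quotients over
    all tuples of n - 1 entries factors as X times a power of a harmonic sum.
    Tuples with a zero entry contribute nothing to it, as 0^-1 = 0. *)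
Lemma card_tuples_le (R : realType) (n X : nat) : (0 < n)%N -> (0 < X)%N ->
  (#|tuples_le n X|%:R : R) <= X%:R * (1 + ln X%:R) ^+ n.-1.
Proof.
case: n => // n; case: X => // X _ _ /=; set Y := X.+1.
pose rest (f : {ffun 'I_n.+1 -> 'I_Y.+1}) : {ffun 'I_n -> 'I_Y.+1} := [ffun j => f (lift
  ord0 j)].
have H0 (t : 'I_Y.+1) : 0 <= (t%:R : R)^-1 by rewrite invr_ge0 ler0n.
apply: (@le_trans _ _ (Y%:R * (\sum_(t < Y.+1) (t%:R : R)^-1) ^+ n)); last first.
  rewrite ler_wpM2l ?ler0n //; apply: lerXn2r; rewrite ?nnegrE ?harmonic_le //.
    by apply: sumr_ge0.
  by rewrite addr_ge0 // ln_ge0 // ler1n.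
have -> : (\sum_(t < Y.+1) (t%:R : R)^-1) ^+ n =
    \sum_(g : {ffun 'I_n -> 'I_Y.+1}) \prod_j ((g j)%:R : R)^-1.
  by rewrite -[X in _ ^+ X](card_ord n) -prodr_const bigA_distr_bigA.
rewrite -sum1_card (partition_big rest xpredT) //= natr_sum mulr_sumr.
apply: ler_sum => g _; rewrite sum1_card.
case: (posnP (\prod_j g j)) => [P0|P0].
  have -> : #|[pred f in tuples_le n.+1 Y | rest f == g]| = 0%N.
    apply/eqP; rewrite -leqn0 leqNgt; apply/negP=> /card_gt0P[f]; rewrite !inE.
    move=> /andP[/andP[/forallP f0 _] /eqP Eg]; move/eqP: P0; apply/negP; rewrite -lt0n.
    by apply: prodn_gt0 => j; rewrite -Eg ffunE.
  by rewrite mulr_ge0 ?ler0n // prodr_ge0.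
have -> : \prod_j ((g j)%:R : R)^-1 = ((\prod_j g j)%N%:R)^-1.
  by rewrite natr_prod prodfV.
rewrite ler_pdivlMr ?ltr0n // -natrM ler_nat.
apply: leq_trans (leq_trunc_div Y (\prod_j g j)); rewrite leq_mul2r; apply/orP; right.
apply: leq_trans (tuples_le_fiber P0).
by apply: eq_leq; apply: eq_card => f; rewrite unfold_in [RHS]inE.
Qed.

(** * Real embeddings *)

Lemma separable_element_char0 (F : fieldExtType rat) (x : F) : separable_element 1 x.
Proof.
rewrite separable_nz_der; apply/eqP=> /polyP/(_ (adjoin_degree 1 x).-1).
rewrite coef_deriv coef0 prednK //.
have := monic_minPoly 1 x; rewrite monicE lead_coefE size_minPoly /= => /eqP-> /eqP.
by rewrite -scaler_nat scaler_eq0 pnatr_eq0 oner_eq0 orbF.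
Qed.

Lemma primitive_element (F : fieldExtType rat) :
  exists theta : F, <<1; theta>>%VS = {:F}%VS.
Proof.
exists (separable_generator 1%AS {:F}%AS); symmetry.
apply: (@eq_adjoin_separable_generator _ _ {:F}%AS 1%AS); last exact: subvf.
by apply/separableP=> y _; apply: separable_element_char0.
Qed.

Lemma rmorph_ratr (F : fieldExtType rat) (K : numFieldType) (s : {rmorphism F -> K})
  (q : rat) (x : F) : s (q *: x) = ratr q * s x.
Proof.
rewrite -[x in LHS]mul1r scalerAl rmorphM; congr (_ * _).
by rewrite -(fmorph_eq_rat (s \o in_alg F)).
Qed.

Lemma rmorph_horner_rat (F : fieldExtType rat) (K : numFieldType) (s : {rmorphism F -> K})
  (q : {poly rat}) (x : F) :
  s (map_poly (in_alg F) q).[x] = (map_poly ratr q).[s x].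
Proof.
rewrite -horner_map -map_poly_comp /=; congr (_.[_]); apply: eq_map_poly => a /=.
by rewrite rmorph_ratr rmorph1 mulr1.
Qed.

Section Primitive.
Variables (F : fieldExtType rat) (theta : F) (p : {poly rat}).
Hypothesis theta_gen : <<1; theta>>%VS = {:F}%VS.
Hypothesis p_min : minPoly 1 theta = map_poly (in_alg F) p.

Lemma size_rat_minPoly : size p = (\dim {:F}).+1.
Proof.
rewrite -(size_map_poly (in_alg F)) -p_min size_minPoly; congr _.+1.
by rewrite -theta_gen dim_Fadjoin dimv1 muln1.
Qed.

Lemma rat_minPoly_dvd (q : {poly rat}) :
  (map_poly (in_alg F) q).[theta] = 0 -> p %| q.
Proof.
move=> q0; rewrite -(dvdp_map (in_alg F)) -p_min minPoly_dvdp //; last exact/rootP.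
by apply/polyOver1P; exists q.
Qed.

Lemma polynomial_in_generator (x : F) : exists q : {poly rat}, x = (map_poly (in_alg F)
  q).[theta].
Proof. by apply/Fadjoin1_polyP; rewrite theta_gen memvf. Qed.

(** The map sending g(theta) to g(z) is well defined because p divides every
    rational polynomial that vanishes at theta. *)
Lemma embedding_of_root (K : numFieldType) (z : K) :
  root (map_poly ratr p) z -> exists s : {rmorphism F -> K}, s theta = z.
Proof.
move=> pz; have [q Eq] := choice polynomial_in_generator.
pose f x := (map_poly ratr (q x)).[z].
have f_spec (g : {poly rat}) : f (map_poly (in_alg F) g).[theta] = (map_poly ratr g).[z].
  apply/eqP; rewrite -subr_eq0 -hornerN -hornerD -rmorphB /=.
  have /dvdpP[h ->] : p %| q (map_poly (in_alg F) g).[theta] - g.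
    by apply: rat_minPoly_dvd; rewrite rmorphB hornerD hornerN -Eq subrr.
  by rewrite rmorphM hornerM (rootP pz) mulr0.
have fB : {morph f : x y / x - y}.
  move=> x y; rewrite [in LHS](Eq x) [in LHS](Eq y) -hornerN -hornerD -rmorphB f_spec.
  by rewrite rmorphB hornerD hornerN.
have fM : monoid_morphism f.
  split=> [|x y]; last first.
    by rewrite [in LHS](Eq x) [in LHS](Eq y) -hornerM -rmorphM f_spec rmorphM hornerM.
  have -> : 1 = (map_poly (in_alg F) 1).[theta] by rewrite rmorph1 hornerC.
  by rewrite f_spec rmorph1 hornerC.
pose fa := GRing.isZmodMorphism.Build F K f fB.
pose fm := GRing.isMonoidMorphism.Build F K f fM.
pose s : {rmorphism F -> K} := HB.pack f fa fm.
exists s; have -> : theta = (map_poly (in_alg F) 'X).[theta] by rewrite map_polyX hornerX.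
by rewrite [LHS]f_spec map_polyX hornerX.
Qed.

Lemma embedding_ext (K : numFieldType) (s t : {rmorphism F -> K}) :
  s theta = t theta -> s =1 t.
Proof.
by move=> st x; have [q ->] := polynomial_in_generator x; rewrite !rmorph_horner_rat st.
Qed.

Lemma separable_rat_minPoly : separable_poly p.
Proof.
rewrite -(separable_map (in_alg F)) -p_min; exact: separable_element_char0.
Qed.

Lemma root_embedding (K : numFieldType) (s : {rmorphism F -> K}) :
  root (map_poly ratr p) (s theta).
Proof.
by apply/rootP; rewrite -rmorph_horner_rat -p_min minPolyxx rmorph0.
Qed.

End Primitive.

(** A totally real field of degree d has d real embeddings. Their distinctness
    is recorded as separation by a single element theta, the form in which a
    Vandermonde determinant can use it. *)
Lemma real_embeddings (R : realType) (F : fieldExtType rat) :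
  totally_real R F ->
  exists (theta : F) (sigma : 'I_(\dim {:F}) -> {rmorphism F -> R}),
    [/\ <<1; theta>>%VS = {:F}%VS, injective (fun j => sigma j theta) &
        forall s : {rmorphism F -> R}, exists j, s =1 sigma j].
Proof.
move=> totr; have [theta gen] := primitive_element F; exists theta.
have /polyOver1P[p p_min] := minPolyOver 1 theta.
have sp := size_rat_minPoly gen p_min.
have lp : lead_coef p = 1.
  apply: (fmorph_inj (in_alg F)); rewrite -lead_coef_map -p_min.
  by rewrite (monicP (monic_minPoly 1 theta)) rmorph1.
have [zs Ezs] := closed_field_poly_normal (map_poly ratr p : {poly R[i]}).
rewrite lead_coef_map lp rmorph1 scale1r in Ezs.
have uzs : uniq zs.
  by rewrite -separable_prod_XsubC -Ezs separable_map (separable_rat_minPoly p_min).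
have szs : size zs = \dim {:F}.
  by apply: succn_inj; rewrite -(size_prod_XsubC zs id) -Ezs size_map_poly sp.
have rz (j : 'I_(\dim {:F})) : root (map_poly ratr p) zs`_j.
  by rewrite Ezs root_prod_XsubC mem_nth // szs.
have [s Es] := choice (fun j => embedding_of_root gen p_min (rz j)).
have fB j : {morph (fun x => complex.Re (s j x)) : x y / x - y}.
  by move=> x y; rewrite rmorphB raddfB.
have sR j x : s j x = (complex.Re (s j x))%:C%C by rewrite RRe_real // totr.
have fM j : monoid_morphism (fun x => complex.Re (s j x)).
  split=> [|x y]; first by rewrite rmorph1.
  by apply: (@complexI R); rewrite [RHS]rmorphM /= -!sR rmorphM.
pose sigma j : {rmorphism F -> R} :=
  HB.pack (fun x => complex.Re (s j x))
    (GRing.isZmodMorphism.Build F R _ (fB j)) (GRing.isMonoidMorphism.Build F R _ (fM j)).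
exists sigma; split=> // [j k|t].
  move/(congr1 (real_complex R)); rewrite -!sR !Es => /eqP.
  by rewrite nth_uniq ?szs // => /eqP/val_inj.
have := root_embedding p_min (real_complex R \o t).
rewrite Ezs root_prod_XsubC => /(nthP 0)[j]; rewrite szs => jd Ej.
exists (Ordinal jd); apply: (embedding_ext gen).
by apply: (@complexI R); rewrite -sR Es Ej.
Qed.

(** * Rings of integers under the real embeddings *)

Section IntegerRing.
Variable F : fieldExtType rat.
Implicit Types x y : F.

Lemma natr_ext_eq0 (m : nat) : (m%:R == 0 :> F) = (m == 0)%N.
Proof. by rewrite -(rmorph_nat (in_alg F)) fmorph_eq0 pnatr_eq0. Qed.

Lemma is_integerD x y : is_integer x -> is_integer y -> is_integer (x + y).
Proof. exact: integral_add. Qed.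
Lemma is_integerN x : is_integer x -> is_integer (- x).
Proof. exact: integral_opp. Qed.
Lemma is_integerB x y : is_integer x -> is_integer y -> is_integer (x - y).
Proof. exact: integral_sub. Qed.
Lemma is_integerM x y : is_integer x -> is_integer y -> is_integer (x * y).
Proof. exact: integral_mul. Qed.
Lemma is_integer_int (m : int) : is_integer (m%:~R : F).
Proof. exact: integral_id. Qed.
Lemma is_integer_nat (m : nat) : is_integer (m%:R : F).
Proof. exact: integral_nat. Qed.
Lemma is_integer0 : is_integer (0 : F). Proof. exact: integral0. Qed.
Lemma is_integer1 : is_integer (1 : F). Proof. exact: integral1. Qed.
Lemma is_integerX x n : is_integer x -> is_integer (x ^+ n).
Proof.
by move=> Ix; elim: n => [|n IH]; [exact: is_integer1|rewrite exprS; exact: is_integerM].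
Qed.
Lemma is_integerMz x (m : int) : is_integer x -> is_integer (x *~ m).
Proof. by move=> Ix; rewrite -mulrzr; apply: is_integerM => //; apply: is_integer_int. Qed.
Lemma is_integer_sum (I : Type) (r : seq I) (P : pred I) (E : I -> F) :
  (forall i, P i -> is_integer (E i)) -> is_integer (\sum_(i <- r | P i) E i).
Proof. by move=> IE; elim/big_rec: _ => [|i y Pi Iy];
  [exact: is_integer0|apply: is_integerD; auto]. Qed.
Lemma is_integer_prod (I : Type) (r : seq I) (P : pred I) (E : I -> F) :
  (forall i, P i -> is_integer (E i)) -> is_integer (\prod_(i <- r | P i) E i).
Proof. by move=> IE; elim/big_rec: _ => [|i y Pi Iy];
  [exact: is_integer1|apply: is_integerM; auto]. Qed.

Lemma integral_basis_basis (n : nat) (b : n.-tuple F) :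
  n = \dim {:F} -> integral_basis b -> basis_of {:F} b.
Proof.
move=> En [_ bU]; rewrite basisEfree subvf size_tuple -{1}En leqnn /= andbT.
apply/freeP=> q q0 i.
have [k k0 [A EA]] := common_denominator (\row_j q j : 'rV_n).
have EAj j : (A 0 j)%:~R = k%:R * q j by move/rowP/(_ j): EA; rewrite !mxE.
have [c [_ cU]] := bU 0 is_integer0.
have c0 : c = [ffun=> 0] by apply: cU; rewrite big1 // => j _; rewrite ffunE mulr0z.
have cA : c = [ffun j => A 0 j].
  apply: cU; transitivity (k%:R *: \sum_(j < n) q j *: b`_j); first by rewrite q0 scaler0.
  rewrite scaler_sumr; apply: eq_bigr => j _.
  by rewrite scalerA -EAj ffunE scaler_int (tnth_nth 0).
have : (A 0 i)%:~R = 0 :> rat by move: cA; rewrite c0 => /ffunP/(_ i); rewrite !ffunE => <-.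
by move/eqP; rewrite EAj mulf_eq0 pnatr_eq0 => /orP[/eqP k00|/eqP //]; rewrite k00 in k0.
Qed.

End IntegerRing.

Section Embeddings.
Variables (R : realType) (F : fieldExtType rat) (theta : F).
Let n := \dim {:F}.
Variable sigma : 'I_n -> {rmorphism F -> R}.
Hypothesis sigma_inj : injective (fun j => sigma j theta).

Definition embed_mx (e : n.-tuple F) : 'M[R]_n := \matrix_(i, j) sigma j e`_i.

Lemma embed_coord (e : n.-tuple F) (x : F) (j : 'I_n) : basis_of {:F} e ->
  sigma j x = \sum_i ratr (coord e i x) * sigma j e`_i.
Proof.
move=> eB; rewrite [in LHS](coord_basis eB (memvf x)) rmorph_sum.
by apply: eq_bigr => i _; rewrite rmorph_ratr.
Qed.

(** Multiplying by the coordinates of the powers of theta in the basis e turns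
    this matrix into a Vandermonde matrix with distinct nodes. *)
Lemma embed_mx_unit (e : n.-tuple F) : basis_of {:F} e -> embed_mx e \in unitmx.
Proof.
move=> eB.
pose W := Vandermonde n (\row_j sigma j theta).
have EW : W = (\matrix_(k, i) ratr (coord e i (theta ^+ k))) *m embed_mx e.
  apply/matrixP=> k j; rewrite !mxE -rmorphXn (embed_coord _ _ eB).
  by apply: eq_bigr => i _; rewrite !mxE.
have : W \in unitmx.
  rewrite unitmxE det_Vandermonde unitfE; apply/prodf_neq0 => i _.
  apply/prodf_neq0 => j ij; rewrite !mxE subr_eq0; apply/eqP=> /sigma_inj E.
  by rewrite E ltnn in ij.
by rewrite EW unitmx_mul => /andP[].
Qed.

Lemma embed_mx_diag (e : n.-tuple F) (x : F) (M : 'M[R]_n) :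
  (forall i j, \sum_k M i k * sigma j e`_k = sigma j (x * e`_i)) ->
  M *m embed_mx e = embed_mx e *m diag_mx (\row_j sigma j x).
Proof.
move=> H; apply/matrixP=> i j; rewrite mul_mx_diag !mxE mulrC -rmorphM -H.
by apply: eq_bigr => k _; rewrite !mxE.
Qed.

(** [embed_mx] diagonalizes multiplication by x, with eigenvalues sigma j x. *)
Lemma mul_mx_det_tr (e : n.-tuple F) (x : F) (M : 'M[R]_n) : basis_of {:F} e ->
  (forall i j, \sum_k M i k * sigma j e`_k = sigma j (x * e`_i)) ->
  \det M = \prod_j sigma j x /\ \tr M = \sum_j sigma j x.
Proof.
move=> eB H; have uV := embed_mx_unit eB.
have -> : M = embed_mx e *m diag_mx (\row_j sigma j x) *m invmx (embed_mx e).
  by rewrite -(embed_mx_diag H) mulmxK.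
split; last by rewrite mxtrace_mulC mulKmx // mxtrace_diag; apply: eq_bigr => j _;
  rewrite mxE.
rewrite !det_mulmx mulrAC det_inv mulfV -?unitfE -?unitmxE // mul1r det_diag.
by apply: eq_bigr => j _; rewrite mxE.
Qed.

Lemma field_trace_embed (x : F) : ratr (field_trace x) = \sum_j sigma j x.
Proof.
pose e := vbasis {:F}; have eB : basis_of {:F} e := vbasisP _.
have := @mul_mx_det_tr e x (map_mx ratr (passmx.mxof e e (amull x))) eB.
case=> [i j|_ <-]; last by rewrite -(trace_map_mx (ratr : {rmorphism rat -> R})).
rewrite (embed_coord _ _ eB); apply: eq_bigr => k _.
by rewrite !mxE /= passmx.vecof_delta lfunE.
Qed.

Variable b : n.-tuple F.
Hypothesis bI : integral_basis b.
Let bB : basis_of {:F} b := integral_basis_basis erefl bI.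

Lemma embed_sum_int (c : 'I_n -> int) j :
  sigma j (\sum_(i < n) b`_i *~ c i) = \sum_(i < n) (c i)%:~R * sigma j b`_i.
Proof.
rewrite rmorph_sum; apply: eq_bigr => i _.
by rewrite -mulrzr rmorphM rmorph_int mulrC.
Qed.

Lemma integer_mul_mx (x : F) : is_integer x ->
  exists A : 'M[int]_n,
    [/\ forall i : 'I_n, x * b`_i = \sum_(j < n) b`_j *~ A i j,
        (\det A)%:~R = \prod_j sigma j x & (\tr A)%:~R = \sum_j sigma j x].
Proof.
move=> Ix; have [bint bex] := bI.
have Hc (i : 'I_n) : exists c : {ffun 'I_n -> int}, x * b`_i = \sum_(j < n) b`_j *~ c j.
  have [|c [Ec _]] := bex (x * b`_i); first by have := bint i; rewrite (tnth_nth 0);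
    apply: is_integerM.
  by exists c; rewrite Ec; apply: eq_bigr => j _; rewrite (tnth_nth 0).
have [c Ec] := choice Hc; exists (\matrix_(i, j) c i j).
have := @mul_mx_det_tr b x (map_mx intr (\matrix_(i, j) c i j)) bB.
case=> [i j|Ed Et].
  by rewrite Ec embed_sum_int; apply: eq_bigr => k _; rewrite !mxE.
split=> [i||]; first by rewrite Ec; apply: eq_bigr => j _; rewrite mxE.
  by rewrite -Ed (det_map_mx (intr : {rmorphism int -> R})).
by rewrite -Et (trace_map_mx (intr : {rmorphism int -> R})).
Qed.

Lemma disc_embed (D : int) :
  \det (\matrix_(i, j) field_trace (tnth b i * tnth b j)) = D%:~R ->
  D%:~R = (\det (embed_mx b)) ^+ 2.
Proof.
move=> ED; rewrite expr2 -[X in _ * X]det_tr -det_mulmx.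
have -> : D%:~R = ratr D%:~R :> R by rewrite ratr_int.
rewrite -ED -(det_map_mx (ratr : {rmorphism rat -> R})); congr (\det _).
apply/matrixP=> i j; rewrite !mxE /= field_trace_embed; apply: eq_bigr => k _.
by rewrite !mxE rmorphM !(tnth_nth 0).
Qed.

End Embeddings.

(** * Norms of integers *)

Section Norm.
Variables (R : realType) (F : fieldExtType rat) (theta : F).
Let n := \dim {:F}.
Variable sigma : 'I_n -> {rmorphism F -> R}.
Hypothesis sigma_inj : injective (fun j => sigma j theta).
Variable b : n.-tuple F.
Hypothesis bI : integral_basis b.

(** The norm of an integer is a rational integer, so the floor does not change
    it. *)
Definition abs_norm (x : F) : nat := `|Num.floor (\prod_j sigma j x)|%N.

Lemma abs_norm_det (x : F) (z : int) : \prod_j sigma j x = z%:~R -> abs_norm x = `|z|%N.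
Proof. by rewrite /abs_norm => ->; rewrite intrKfloor. Qed.

Lemma abs_normE (x : F) : is_integer x -> (abs_norm x)%:R = `|\prod_j sigma j x|.
Proof.
move=> Ix; have [A [_ Ed _]] := integer_mul_mx sigma_inj bI Ix.
by rewrite (abs_norm_det (esym Ed)) -Ed -intr_norm natr_absz.
Qed.

Lemma abs_normM (x y : F) : is_integer x -> is_integer y ->
  abs_norm (x * y) = (abs_norm x * abs_norm y)%N.
Proof.
move=> Ix Iy; apply/eqP; rewrite -(eqr_nat R) natrM !abs_normE //; last exact: is_integerM.
by rewrite -normrM -big_split /=; apply/eqP; congr `|_|; apply: eq_bigr => j _;
  rewrite rmorphM.
Qed.

Lemma abs_norm_nat (m : nat) : abs_norm m%:R = (m ^ n)%N.
Proof.
rewrite (@abs_norm_det _ (m ^ n)%N) // (eq_bigr (fun=> m%:R)) => [|j _];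
  last exact: rmorph_nat.
by rewrite prodr_const card_ord -natrX.
Qed.

Lemma abs_norm_gt0 (x : F) : is_integer x -> x != 0 -> (0 < abs_norm x)%N.
Proof.
move=> Ix x0; rewrite -(ltr_nat R) abs_normE // normr_gt0; apply/prodf_neq0 => j _.
by rewrite fmorph_eq0.
Qed.

(** If A is the matrix of multiplication by x in the basis b, then A b = x b,
    and multiplying by the adjugate of A gives (det A / x) b = adj(A) b, whose
    entries are integers. Now express 1 in the basis b. *)
Lemma abs_norm_div (x : F) : is_integer x -> x != 0 -> is_integer ((abs_norm x)%:R / x).
Proof.
move=> Ix x0; have [A [EA Ed _]] := integer_mul_mx sigma_inj bI Ix.
set z := \det A in Ed.
have Ez : is_integer (z%:~R / x).
  pose v : 'cV[F]_n := \col_i b`_i.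
  have EAv : map_mx intr A *m v = x *: v.
    apply/colP=> i; rewrite !mxE EA; apply: eq_bigr => j _.
    by rewrite !mxE -[RHS]mulrzr mulrC.
  have Eadj : (z%:~R / x) *: v = map_mx intr (\adj A) *m v.
    apply: (scalerI x0); rewrite scalerA mulrCA mulfV // mulr1 scalemxAr -EAv mulmxA.
    by rewrite -map_mxM /= mul_adj_mx map_scalar_mx /= mul_scalar_mx.
  have Ib (i : 'I_n) : is_integer (z%:~R / x * b`_i).
    move/colP/(_ i): Eadj; rewrite !mxE => ->; apply: is_integer_sum => j _.
    rewrite !mxE; apply: is_integerM; first exact: is_integer_int.
    by case: bI => bint _; have := bint j; rewrite (tnth_nth 0).
  have [_ bex] := bI; have [c [Ec _]] := bex 1 (is_integer1 F).
  rewrite -[_ / x]mulr1 [X in _ * X]Ec mulr_sumr; apply: is_integer_sum => i _.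
  by rewrite (tnth_nth 0) mulrzAr; apply: is_integerMz; apply: Ib.
rewrite (abs_norm_det (esym Ed)).
have -> : `|z|%N%:R = (if 0 <= z then z else - z)%:~R :> F.
  by rewrite pmulrn; congr (_%:~R); case: ifP => h; lia.
by case: ifP => _ //; rewrite rmorphN mulNr; apply: is_integerN.
Qed.

(** Modulo p, the matrix of multiplication by m + p z is the scalar matrix m. *)
Lemma abs_norm_mod (p m : nat) (z : F) : prime p -> ~~ (p %| m)%N -> is_integer z ->
  ~~ (p %| abs_norm (m%:R + p%:R * z))%N.
Proof.
move=> pp pm Iz; have [A [EA _ _]] := integer_mul_mx sigma_inj bI Iz.
pose B : 'M[int]_n := m%:Z%:M + p%:Z *: A.
have EB : \det (map_mx intr B) = \prod_j sigma j (m%:R + p%:R * z) :> R.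
  apply: proj1 (mul_mx_det_tr sigma_inj (integral_basis_basis erefl bI) _) => i j.
  rewrite mulrDl -mulrA EA [RHS]rmorphD /= !rmorphM !rmorph_nat (embed_sum_int sigma).
  rewrite mulr_sumr.
  rewrite (eq_bigr (fun k => (i == k)%:R * (m%:R * sigma j b`_i) +
      p%:R * ((A i k)%:~R * sigma j b`_k))) => [|k _].
    rewrite big_split /= (bigD1 i) //= eqxx mul1r big1 ?addr0 // => k ki.
    by rewrite eq_sym (negPf ki) mul0r.
  rewrite !mxE rmorphD rmorphM /= mulrDl -mulrA; congr (_ + _).
  by case: eqP => [->|_]; rewrite ?mulr1n ?mulr0n ?mul1r // !mul0r.
rewrite (det_map_mx (intr : {rmorphism int -> R})) in EB.
rewrite (abs_norm_det (esym EB)).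
have chp := pchar_Fp pp.
rewrite (dvdn_pcharf chp).
have -> : `|\det B|%N%:R == 0 :> 'F_p = ((\det B)%:~R == 0 :> 'F_p).
  have [{2}->|{2}->] : \det B = `|\det B|%N%:Z \/ \det B = - `|\det B|%N%:Z by lia.
    by [].
  by rewrite rmorphN /= oppr_eq0.
rewrite -(det_map_mx (intr : {rmorphism int -> 'F_p})).
have -> : map_mx intr B = (m%:R : 'F_p)%:M.
  rewrite map_mxD map_scalar_mx map_mxZ /= -!pmulrn (pcharf0 chp) scale0r addr0 //.
by rewrite det_scalar expf_eq0 negb_and -(dvdn_pcharf chp) pm orbT.
Qed.

Lemma residue_classes (m : nat) : (0 < m)%N ->
  exists f : F -> {ffun 'I_n -> 'I_m},
    forall x y, is_integer x -> is_integer y -> f x = f y -> is_integer ((x - y) / m%:R).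
Proof.
move=> m0; have [bint bex] := bI.
have H x : exists c : {ffun 'I_n -> int}, is_integer x -> x = \sum_(i < n) tnth b i *~ c i.
  case: (pselect (is_integer x)) => [Ix|//]; last by exists [ffun=> 0].
  by have [c [Ec _]] := bex x Ix; exists c.
have [c Ec] := choice H.
have lt x i : (`|(c x i %% m%:Z)%Z| < m)%N.
  by have := ltz_mod (c x i) (d := m%:Z); have := modz_ge0 (c x i) (d := m%:Z); lia.
exists (fun x => [ffun i => Ordinal (lt x i)]) => x y Ix Iy /ffunP Exy.
have Hq i : exists q : int, c x i = c y i + q * m%:Z.
  have /(congr1 val) := Exy i; rewrite !ffunE /= => E.
  exists ((c x i %/ m%:Z)%Z - (c y i %/ m%:Z)%Z).
  have := modz_ge0 (c x i) (d := m%:Z); have := modz_ge0 (c y i) (d := m%:Z).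
  by have := divz_eq (c x i) m; have := divz_eq (c y i) m; move: E; lia.
have [q Eq] := choice Hq.
have -> : (x - y) / m%:R = \sum_(i < n) tnth b i *~ q i; last first.
  by apply: is_integer_sum => i _; apply: is_integerMz.
rewrite {1}(Ec x Ix) {1}(Ec y Iy) -sumrB mulr_suml; apply: eq_bigr => i _.
have m0F : m%:R != 0 :> F by rewrite natr_ext_eq0 -lt0n.
rewrite Eq mulrzDr addrAC subrr add0r -[_ *~ (_ * _)]mulrzr rmorphM /= mulrA mulfK //.
by rewrite mulrzr.
Qed.

End Norm.

(** * Localization at a prime *)

(** The partial sums f_k + f_(k+1) s + f_(k+2) s^2 + ... of Horner's scheme. *)
Definition horner_tail (F : fieldType) (f : {poly int}) (s : F) (k : nat) : F :=
  \sum_(k <= i < size f) (f`_i)%:~R * s ^+ (i - k).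

Lemma horner_tailS (F : fieldType) (f : {poly int}) (s : F) (k : nat) :
  horner_tail f s k = (f`_k)%:~R + s * horner_tail f s k.+1.
Proof.
rewrite /horner_tail; case: (ltnP k (size f)) => kf.
  rewrite big_ltn // subnn expr0 mulr1; congr (_ + _).
  rewrite mulr_sumr big_nat [RHS]big_nat; apply: eq_bigr => i /andP[ki _].
  by rewrite mulrCA -exprS subnSK.
by rewrite !big_geq // ?mulr0 ?addr0 ?nth_default // ltnW.
Qed.

Lemma horner_tail0 (F : fieldType) (f : {poly int}) (s : F) :
  horner_tail f s 0 = (map_poly intr f).[s].
Proof.
rewrite /horner_tail (@horner_coef_wide _ (size f)) ?size_poly // big_mkord.
by apply: eq_bigr => i _; rewrite subn0 coef_map.
Qed.

Lemma horner_tail_split (F : fieldType) (f : {poly int}) (s : F) (k : nat) :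
  horner_tail f s 0 = \sum_(i < k) (f`_i)%:~R * s ^+ i + horner_tail f s k * s ^+ k.
Proof.
elim: k => [|k IH]; first by rewrite big_ord0 add0r expr0 mulr1.
rewrite IH big_ord_recr /= -addrA; congr (_ + _).
by rewrite horner_tailS mulrDl exprS; ring.
Qed.

(** Descending induction on k. If h is the sum from k + 1 on, the relation f(s)
    = 0 reads h s^(k+1) + f_k s^k + ... + f_0 = 0; multiplied by h^k it is a
    monic equation for h s, with integral coefficients. *)
Lemma horner_tail_integer (F : fieldExtType rat) (f : {poly int}) (s : F) (k : nat) :
  (map_poly intr f).[s] = 0 -> is_integer (horner_tail f s k).
Proof.
move=> fs0; have [m] := ubnP (size f - k)%N; elim: m k => // m IH k mk.
case: (leqP (size f) k) => fk.
  by rewrite /horner_tail big_geq //; apply: is_integer0.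
rewrite horner_tailS; apply: is_integerD; first exact: is_integer_int.
have Ih : is_integer (horner_tail f s k.+1) by apply: IH; lia.
set h := horner_tail f s k.+1 in Ih *.
pose c i : F := (f`_i)%:~R * h ^+ (k - i).
pose q : {poly F} := 'X^(k.+1) + \poly_(i < k.+1) c i.
have sq : (size (\poly_(i < k.+1) c i : {poly F}) <= k.+1)%N by apply: size_poly.
apply: (@integral_root_monic _ _ _ _ q).
- by rewrite monicE lead_coefDl ?lead_coefXn // size_polyXn ltnS.
- apply/rootP; rewrite hornerD hornerXn horner_poly.
  have := horner_tail_split f s k.+1; rewrite horner_tail0 fs0 -/h.
  move/(congr1 (fun z => h ^+ k * z)); rewrite mulr0 mulrDr addrC => E.
  rewrite [RHS]E; congr (_ + _); first by rewrite exprMn (exprSr h k) mulrC mulrA.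
  rewrite [RHS]mulr_sumr; apply: eq_bigr => i _; rewrite /c exprMn.
  have -> : h ^+ k = h ^+ (k - i) * h ^+ i by rewrite -exprD subnK // -ltnS.
  by ring.
- move=> z /(nthP 0)[i _ <-]; rewrite coefD coefXn coef_poly.
  apply: is_integerD; first by case: eqP => _; [exact: is_integer1|exact: is_integer0].
  case: ifP => _; last exact: is_integer0.
  by apply: is_integerM; [exact: is_integer_int|exact: is_integerX].
Qed.

Lemma primitive_annihilator (F : fieldExtType rat) (s : F) :
  exists2 f : {poly int}, (map_poly intr f).[s] = 0 & zcontents f = 1.
Proof.
have /polyOver1P[q Eq] := minPolyOver 1 s.
have [r [a a0 Er]] := rat_poly_scale q.
have q0 : q != 0.
  by rewrite -(map_poly_eq0 (in_alg F)) -Eq monic_neq0 ?monic_minPoly.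
have r0 : r != 0 by apply: contra q0 => /eqP r0; rewrite Er r0 rmorph0 scaler0.
exists (zprimitive r); last by rewrite zcontents_primitive r0.
have c0 : (zcontents r)%:~R != 0 :> F.
  by rewrite -(rmorph_int (in_alg F)) fmorph_eq0 intr_eq0 zcontents_eq0.
have a0F : a%:~R != 0 :> F.
  by rewrite -(rmorph_int (in_alg F)) fmorph_eq0 intr_eq0.
have : (map_poly intr r : {poly F}).[s] = 0.
  have E : map_poly (in_alg F) q = a%:~R^-1 *: map_poly intr r.
    rewrite Er map_polyZ fmorphV rmorph_int -map_poly_comp; congr (_ *: _).
    by apply: eq_map_poly => x; apply: (rmorph_int (in_alg F)).
  have := minPolyxx 1 s; rewrite Eq E hornerZ => /eqP.
  by rewrite mulf_eq0 invr_eq0 (negPf a0F) => /eqP.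
rewrite {1}(zpolyEprim r) map_polyZ hornerZ => /eqP.
by rewrite mulf_eq0 (negPf c0) => /eqP.
Qed.

Section Local.
Variables (F : fieldExtType rat) (p : nat).
Hypothesis p_prime : prime p.
Implicit Types x y s : F.

(** The integers of F localized at the rational prime p. *)
Definition local_int x : Prop := exists2 m : nat, ~~ (p %| m)%N & is_integer (m%:R * x).
Local Notation A := local_int.

Lemma integer_local x : is_integer x -> A x.
Proof. by exists 1%N; rewrite ?mul1r // Euclid_dvd1. Qed.

Lemma localM x y : A x -> A y -> A (x * y).
Proof.
move=> [m pm Ix] [k pk Iy]; exists (m * k)%N; first by rewrite Euclid_dvdM // negb_or pm.
by rewrite natrM mulrACA; apply: is_integerM.
Qed.

Lemma localD x y : A x -> A y -> A (x + y).
Proof.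
move=> [m pm Ix] [k pk Iy]; exists (m * k)%N; first by rewrite Euclid_dvdM // negb_or pm.
rewrite natrM mulrDr -[_ * _ * y]mulrA [_ * _ * x]mulrAC.
by apply: is_integerD; apply: is_integerM => //; apply: is_integer_nat.
Qed.

Lemma local_int_cast (m : int) : A m%:~R.
Proof. exact/integer_local/is_integer_int. Qed.
Lemma local_nat (m : nat) : A m%:R.
Proof. exact/integer_local/is_integer_nat. Qed.
Lemma local1 : A 1. Proof. exact: (local_nat 1). Qed.
Lemma local0 : A 0. Proof. exact: (local_nat 0). Qed.
Lemma localN x : A x -> A (- x).
Proof. by rewrite -mulN1r; apply: localM; apply: (local_int_cast (-1)). Qed.
Lemma localB x y : A x -> A y -> A (x - y).
Proof. by move=> Ax Ay; apply/localD/localN. Qed.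
Lemma localX x k : A x -> A (x ^+ k).
Proof. by move=> Ax; elim: k => [|k IH]; [exact: local1|rewrite exprS; apply: localM]. Qed.
Lemma local_sum (I : Type) (r : seq I) (P : pred I) (E : I -> F) :
  (forall i, P i -> A (E i)) -> A (\sum_(i <- r | P i) E i).
Proof. by move=> AE; elim/big_rec: _ => [|i y Pi Ay]; [exact: local0|apply: localD;
  auto]. Qed.
Lemma local_prod (I : Type) (r : seq I) (P : pred I) (E : I -> F) :
  (forall i, P i -> A (E i)) -> A (\prod_(i <- r | P i) E i).
Proof. by move=> AE; elim/big_rec: _ => [|i y Pi Ay]; [exact: local1|apply: localM;
  auto]. Qed.

Lemma local_natV (m : nat) : ~~ (p %| m)%N -> A m%:R^-1.
Proof.
move=> pm; exists m => //; rewrite mulfV ?natr_ext_eq0; first exact: is_integer1.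
by apply: contra pm => /eqP->; apply: dvdn0.
Qed.

Lemma local_intV (m : int) : ~~ (p %| `|m|)%N -> A m%:~R^-1.
Proof.
move/local_natV; case: (intP m) => // k Ak; rewrite rmorphN invrN /=; exact: localN.
Qed.

(** At every prime above p, s or s^-1 is integral, stated without primes: e
    vanishes where s does, and e = -1 where s^-1 does. Take a coefficient f_k
    prime to p of an integral relation f(s) = 0; with h_k the Horner sums, f_k =
    h_k - s h_(k+1), and e = s h_(k+1) / f_k is the required element. *)
Lemma local_dichotomy s : s != 0 ->
  exists e, [/\ A e, A (e / s) & A ((1 + e) * s)].
Proof.
move=> s0; have [f fs0 cf] := primitive_annihilator s.
have Ih k : A (horner_tail f s k) by apply: integer_local; apply: horner_tail_integer.
have [k pk] : exists k : nat, ~~ (p %| `|(f`_k)%R|)%N.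
  apply: contrapT => H; have : (p%:Z %| zcontents f)%Z.
    rewrite dvdz_contents; apply/polyOverP => k; rewrite dvdzE.
    by apply: contrapT => /negP pk; apply: H; exists k.
  by rewrite cf dvdzE /= Euclid_dvd1.
have Vk := local_intV pk; have k0 : (f`_k)%:~R != 0 :> F.
  by rewrite -(rmorph_int (in_alg F)) fmorph_eq0 intr_eq0; apply: contra pk => /eqP->.
have E := horner_tailS f s k.
exists (s * horner_tail f s k.+1 / (f`_k)%:~R); split.
- apply: localM => //; have -> : s * horner_tail f s k.+1 = horner_tail f s k - (f`_k)%:~R.
    by rewrite E addrC addKr.
  by apply: localB => //; apply: local_int_cast.
- have -> : s * horner_tail f s k.+1 / (f`_k)%:~R / s = horner_tail f s k.+1 / (f`_k)%:~R.
    by rewrite mulrC !mulrA mulVf // mul1r.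
  exact: localM.
have -> : (1 + s * horner_tail f s k.+1 / (f`_k)%:~R) * s =
    s * horner_tail f s k / (f`_k)%:~R.
  by rewrite E; move: (f`_k)%:~R (horner_tail f s k.+1) k0 => c t c0; field.
apply: localM => //; case: k {pk Vk k0 E} => [|k].
  by rewrite horner_tail0 fs0 mulr0; exact: local0.
have -> : s * horner_tail f s k.+1 = horner_tail f s k - (f`_k)%:~R.
  by rewrite (horner_tailS f s k) addrC addKr.
by apply: localB => //; apply: local_int_cast.
Qed.

End Local.

Section LocalArith.
Variables (R : realType) (F : fieldExtType rat) (theta : F).
Let n := \dim {:F}.
Variable sigma : 'I_n -> {rmorphism F -> R}.
Hypothesis sigma_inj : injective (fun j => sigma j theta).
Variable b : n.-tuple F.
Hypothesis bI : integral_basis b.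
Variable p : nat.
Hypothesis p_prime : prime p.
Implicit Types x y s : F.
Local Notation A := (local_int p).
Local Notation N := (abs_norm sigma).

Lemma p_neq0 : p%:R != 0 :> F.
Proof. by rewrite natr_ext_eq0 -lt0n prime_gt0. Qed.

Lemma ndvd_neq0 (m : nat) : ~~ (p %| m)%N -> m%:R != 0 :> F.
Proof. by move=> pm; rewrite natr_ext_eq0; apply: contra pm => /eqP->; apply: dvdn0. Qed.

Lemma local_unit x : is_integer x -> ~~ (p %| N x)%N -> A x^-1.
Proof.
move=> Ix pN; have [->|x0] := eqVneq x 0; first by rewrite invr0; apply: local0.
by exists (N x) => //; apply: (abs_norm_div sigma_inj bI).
Qed.

Lemma local_unit_ndvd x : is_integer x -> x != 0 -> A x^-1 -> ~~ (p %| N x)%N.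
Proof.
move=> Ix x0 [m pm Im]; have := abs_norm_nat sigma m.
rewrite -(mulfVK x0 m%:R) mulrC (abs_normM sigma_inj bI) // => E.
have : ~~ (p %| m ^ n)%N by rewrite Euclid_dvdX // negb_and pm.
by rewrite -E; apply: contra; apply: dvdn_mulr.
Qed.

Lemma local_one_add x : A x -> A (1 + p%:R * x)^-1.
Proof.
move=> [m pm Im].
have Iz : is_integer (m%:R + p%:R * (m%:R * x)).
  by apply: is_integerD; [|apply: is_integerM => //]; apply: is_integer_nat.
have Az := local_unit Iz (abs_norm_mod sigma_inj bI p_prime pm Im).
have -> : (1 + p%:R * x)^-1 = m%:R * (m%:R + p%:R * (m%:R * x))^-1.
  have -> : m%:R + p%:R * (m%:R * x) = m%:R * (1 + p%:R * x) by ring.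
  by rewrite invfM mulrA mulfV ?mul1r // ndvd_neq0.
by apply: localM => //; apply: local_nat.
Qed.

Lemma local_one_add_neq0 x : A x -> 1 + p%:R * x != 0.
Proof.
move=> [m pm Im].
have Iz : is_integer (m%:R + p%:R * (m%:R * x)).
  by apply: is_integerD; [|apply: is_integerM => //]; apply: is_integer_nat.
apply/eqP=> E; have := abs_norm_mod sigma_inj bI p_prime pm Im.
have -> : m%:R + p%:R * (m%:R * x) = m%:R * (1 + p%:R * x) by ring.
rewrite E mulr0 -[0]/(0%:R) abs_norm_nat exp0n ?dvdn0 //.
exact: adim_gt0.
Qed.

(** Every element of A is congruent modulo p A to an element of O, by inverting
    its denominator modulo p. *)
Lemma local_residue : exists f : F -> {ffun 'I_n -> 'I_p},
  forall x y, A x -> A y -> f x = f y -> A ((x - y) / p%:R).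
Proof.
have [f Hf] := residue_classes bI (prime_gt0 p_prime).
have H x : exists z, A x -> is_integer z /\ A ((x - z) / p%:R).
  case: (pselect (A x)) => [[m pm Im]|nA]; last by exists 0.
  have [u [v E]] := Bezoutz m p.
  have g1 : gcdz m p = 1.
    by apply/eqP; rewrite -/(coprimez m p) coprimezE /= coprime_sym prime_coprime.
  exists (u%:~R * (m%:R * x)) => _; split.
    by apply: is_integerM => //; apply: is_integer_int.
  have -> : (x - u%:~R * (m%:R * x)) / p%:R = v%:~R * x.
    have /(congr1 (fun k : int => k%:~R : F)) := E.
    rewrite g1 rmorphD !rmorphM /= mulr1z => E'.
    have E'' : 1 - u%:~R * m%:R = v%:~R * p%:R :> F.
      by apply: (canLR (addrK _)); rewrite addrC.
    by rewrite mulrA -[X in X - _]mul1r -mulrBl E'' mulrAC mulfK ?p_neq0.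
  by apply: localM => //; [apply: local_int_cast|exists m].
have [z Hz] := choice H; exists (f \o z) => x y Ax Ay /= Exy.
have [Ix Axz] := Hz x Ax; have [Iy Ayz] := Hz y Ay.
have -> : (x - y) / p%:R = (x - z x) / p%:R + ((z x - z y) / p%:R - (y - z y) / p%:R).
  by rewrite -!mulrBl -mulrDl; congr (_ / _); ring.
by apply: localD => //; apply: localB => //; apply: integer_local => //; apply: Hf.
Qed.

(** The powers of e are eventually periodic modulo p; an exponent that is a
    multiple of the period and lies beyond the preperiod gives an idempotent
    modulo p. *)
Lemma idempotent_power (e : F) : A e -> exists k : nat,
  A ((e ^+ k.+1 * e ^+ k.+1 - e ^+ k.+1) / p%:R).
Proof.
move=> Ae; have [f Hf] := local_residue.
have [i [q [i0 q0 E]]] : exists i q : nat, [/\ (0 < i)%N, (0 < q)%N &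
    f (e ^+ (i + q)) = f (e ^+ i)].
  pose T := {ffun 'I_n -> 'I_p}.
  pose g (i : 'I_(#|{: T}|.+1)) : T := f (e ^+ i.+1).
  have : ~~ injectiveb g.
    by apply/negP=> /injectiveP/leq_card; rewrite card_ord ltnn.
  case/injectivePn=> i [j ij Eg].
  case: (ltngtP i j) => lt.
  - by exists i.+1, (j - i)%N; rewrite subn_gt0 lt addSn subnKC ?(ltnW lt).
  - by exists j.+1, (i - j)%N; rewrite subn_gt0 lt addSn subnKC ?(ltnW lt).
  - by case/eqP: ij; apply: val_inj.
have step t : (i <= t)%N -> A ((e ^+ (t + q) - e ^+ t) / p%:R).
  move=> it; have -> : (e ^+ (t + q) - e ^+ t) / p%:R =
      e ^+ (t - i) * ((e ^+ (i + q) - e ^+ i) / p%:R).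
    by rewrite mulrA mulrBr -!exprD addnA subnK.
  by apply: localM => //; [|apply: Hf] => //; exact: localX.
have steps l t : (i <= t)%N -> A ((e ^+ (t + l * q) - e ^+ t) / p%:R).
  move=> it; elim: l => [|l IH]; first by rewrite mul0n addn0 subrr mul0r; apply: local0.
  have -> : (e ^+ (t + l.+1 * q) - e ^+ t) / p%:R =
     (e ^+ (t + l * q + q) - e ^+ (t + l * q)) / p%:R + (e ^+ (t + l * q) - e ^+ t) / p%:R.
    by rewrite -mulrDl mulSn addrA subrK [(q + _)%N]addnC addnA.
  by apply: localD => //; apply: step; rewrite (leq_trans it) ?leq_addr.
exists (i * q).-1; rewrite prednK ?muln_gt0 ?i0 // -exprD.
by apply: steps; rewrite leq_pmulr.
Qed.

(** With s = x / y and e as in [local_dichotomy], a power eps of - e is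
    idempotent modulo p, is 0 where s vanishes and 1 where s has a pole. Hence z
    = eps x + (1 - eps) y has, at every prime above p, the smaller of the
    valuations of x and y, and divides both. *)
Lemma local_bezout x y : x != 0 -> y != 0 -> exists u v : F,
  [/\ A u, A v, u * x + v * y != 0, A (x / (u * x + v * y)) & A (y / (u * x + v * y))].
Proof.
move=> x0 y0; set s := x / y; have s0 : s != 0 by rewrite mulf_neq0 ?invr_eq0.
have [e [Ae Aes Aes1]] := local_dichotomy p_prime s0.
have [k Ak] := idempotent_power (localN p_prime Ae).
(* The cofactors of the algebraic verification that z divides x and y. *)
pose eta := (- e) ^+ k; pose eps := (- e) ^+ k.+1.
pose delta := (eps * eps - eps) / p%:R.
have Ad : A delta by [].
have Ed : eps * eps = eps + p%:R * delta.
  by rewrite /delta [p%:R * _]mulrC divfK ?p_neq0 // addrC subrK.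
have Eeps : eps = - e * eta by rewrite /eps exprS.
have Aeta : A eta by apply: localX => //; apply: localN.
have Aeps : A eps by apply: localX => //; apply: localN.
pose th := \sum_(i < k.+1) (- e) ^+ i.
have Ath : A th by apply: local_sum => // i _; apply: localX => //; apply: localN.
have Eth : 1 - eps = (1 + e) * th.
  by rewrite /th /eps -{1}(expr1n F k.+1) subrXX opprK; congr (_ * _);
    apply: eq_bigr => i _; rewrite expr1n mul1r.
exists eps, (1 - eps).
set z := eps * x + (1 - eps) * y.
have A1 : A (1 : F) by apply: local1.
have A1e : A (1 - eps) by apply: localB.
(* r1 and r2 combine (eps s + 1 - eps) (1 + e) and (eps s + 1 - eps) e / s, two
   elements of A, into 1 + p w, which is a unit of A. *)
pose w := delta * eta * (e / s) + 3%:R * delta - delta * th * ((1 + e) * s).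
have Aw : A w.
  apply: localB => //; last do 2!apply: localM => //.
  by apply: localD => //; [do 2!apply: localM => //|apply: localM => //; apply: local_nat].
pose r1 := th * (1 - eps); pose r2 := - eta * eps.
have Ar1 : A r1 by apply: localM.
have Ar2 : A r2 by apply: localM => //; apply: localN.
pose kap := (r1 * (1 + e) + r2 * (e / s)) / (1 + p%:R * w).
have w0 := local_one_add_neq0 Aw; have Vw := local_one_add Aw.
have Akap : A kap.
  apply: localM => //; apply: localD => //; apply: localM => //; exact: localD.
have Askap : A (s * kap).
  have -> : s * kap = (r1 * ((1 + e) * s) + r2 * e) / (1 + p%:R * w).
    by rewrite /kap; field; rewrite w0 s0.
  by apply: localM => //; apply: localD => //; apply: localM.
have Ez : z = y * (eps * s + 1 - eps) by rewrite /z /s; field.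
have Ekap : (eps * s + 1 - eps) * kap = 1.
  apply: (mulIf w0); rewrite /kap mulrA divfK // mul1r.
  have -> : (eps * s + 1 - eps) * (r1 * (1 + e) + r2 * (e / s)) =
     (eps * s + 1 - eps) * (((1 + e) * th) * (1 - eps) + (- e * eta) * eps / s).
    by rewrite /r1 /r2; field.
  have -> : p%:R * w = (p%:R * delta) * (3%:R - (- e * eta) / s - ((1 + e) * th) * s).
    by rewrite /w; field.
  rewrite -Eth -Eeps; have -> : p%:R * delta = eps * eps - eps by rewrite Ed addrC addKr.
  by field.
have z0 : z != 0.
  rewrite Ez mulf_neq0 //; apply/eqP=> H; move/eqP: Ekap; rewrite H mul0r.
  by rewrite eq_sym oner_eq0.
have Ey : y / z = kap.
  by apply: (canLR (mulfK z0)); rewrite Ez mulrCA [kap * _]mulrC Ekap mulr1.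
have Ex : x / z = s * kap by rewrite -Ey /s mulrA divfK.
by split=> //; rewrite ?Ex ?Ey.
Qed.

End LocalArith.

Section LocalFactor.
Variables (R : realType) (F : fieldExtType rat) (theta : F).
Let n := \dim {:F}.
Variable sigma : 'I_n -> {rmorphism F -> R}.
Hypothesis sigma_inj : injective (fun j => sigma j theta).
Variable b : n.-tuple F.
Hypothesis bI : integral_basis b.
Variable p : nat.
Hypothesis p_prime : prime p.
Implicit Types x y s : F.
Local Notation A := (local_int p).
Local Notation N := (abs_norm sigma).

Definition local_nonunit x := [/\ is_integer x, x != 0 & (p %| N x)%N].

Definition local_irred x := local_nonunit x /\
  forall y, local_nonunit y -> A (x / y) -> A (y / x).

Lemma local_to_integer x : A x -> x != 0 ->
  exists m : nat, [/\ ~~ (p %| m)%N, is_integer (m%:R * x) & m%:R * x != 0].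
Proof.
move=> [m pm Im] x0; exists m; split=> //; rewrite mulf_neq0 //.
exact: (ndvd_neq0 F pm).
Qed.

Lemma local_natVl (m : nat) x : ~~ (p %| m)%N -> A (m%:R * x) -> A x.
Proof.
move=> pm Amx; rewrite -[x](mulKf (ndvd_neq0 F pm)).
by apply: localM => //; apply: local_natV.
Qed.

Lemma local_natVr (m : nat) x y : ~~ (p %| m)%N -> A (y / x) -> A (y / (m%:R * x)).
Proof.
by move=> pm Ayx; rewrite invfM mulrCA; apply: localM => //; apply: local_natV.
Qed.

(** The Bezout element z of x and y divides x; were it not a unit, x would
    divide z by irreducibility, hence y. *)
Lemma local_irred_coprime x y : local_irred x -> is_integer y -> y != 0 ->
  ~ A (y / x) -> exists u v, [/\ A u, A v & u * x + v * y = 1].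
Proof.
move=> [[Ix x0 px] irrx] Iy y0 nAyx.
have [u [v [Au Av z0 Axz Ayz]]] := local_bezout sigma_inj bI p_prime x0 y0.
set z := u * x + v * y in z0 Axz Ayz.
have Az : A z by apply: localD => //; apply: localM => //; apply: integer_local.
have [m [pm Iz' z'0]] := local_to_integer Az z0.
have nAz' : ~ A (m%:R * z / x).
  move=> Az'x; apply: nAyx; have -> : y / x = (y / z) * (z / x) by rewrite mulrA divfK.
  by apply: localM => //; apply: (local_natVl pm); rewrite mulrA.
have Vz : A (m%:R * z)^-1.
  apply: (local_unit sigma_inj bI) => //; apply/negP=> pz'.
  by apply: nAz'; apply: irrx => //; apply: local_natVr.
have Vz' : A z^-1.
  have -> : z^-1 = m%:R * (m%:R * z)^-1.
    by rewrite invfM mulrA mulfV ?mul1r // (ndvd_neq0 F pm).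
  by apply: localM => //; apply: local_nat.
exists (z^-1 * u), (z^-1 * v); split; try exact: localM.
by rewrite -!mulrA -mulrDr mulVf.
Qed.

Lemma local_irred_nonunit x : local_irred x -> ~ A x^-1.
Proof.
by move=> [[Ix x0 px] _] /(local_unit_ndvd sigma_inj bI p_prime Ix x0) /negP; apply.
Qed.

Lemma local_irred_prime x y z : local_irred x -> is_integer y -> y != 0 -> A z ->
  A (y * z / x) -> A (y / x) \/ A (z / x).
Proof.
move=> irrx Iy y0 Az Ayzx; case: (pselect (A (y / x))) => [|nA]; [by left|right].
have [u [v [Au Av E]]] := local_irred_coprime irrx Iy y0 nA.
have x0 : x != 0 by case: irrx => -[].
have -> : z / x = u * z + v * (y * z / x).
  by rewrite -[z in LHS]mul1r -E; field.
by apply: localD => //; apply: localM.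
Qed.

Lemma local_irred_prod (I : eqType) (r : seq I) (E : I -> F) x : local_irred x ->
  (forall i, i \in r -> is_integer (E i) /\ E i != 0) ->
  A (\prod_(i <- r) E i / x) -> exists2 i, i \in r & A (E i / x).
Proof.
move=> irrx; elim: r => [|i r IH] HE.
  by rewrite big_nil mul1r => /(local_irred_nonunit irrx).
rewrite big_cons; have [Ii Ei0] := HE i (mem_head _ _).
have HE' j : j \in r -> is_integer (E j) /\ E j != 0.
  by move=> jr; apply: HE; rewrite in_cons jr orbT.
have Ap : A (\prod_(j <- r) E j).
  by rewrite big_seq; apply: local_prod => // j /HE'[Ij _]; apply: integer_local.
case/(local_irred_prime irrx Ii Ei0 Ap) => [Aix|/(IH HE')[j jr Ajx]].
  by exists i; rewrite ?mem_head.
by exists j; rewrite // in_cons jr orbT.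
Qed.

Lemma local_irred_dvd_p x : local_irred x -> A (p%:R / x).
Proof.
move=> irrx; apply: contrapT => nA.
have [u [v [Au Av E]]] := local_irred_coprime irrx (is_integer_nat F p) (p_neq0 F
  p_prime) nA.
have x0 : x != 0 by case: irrx => -[].
have Aw := localN p_prime Av.
apply: (local_irred_nonunit irrx).
have -> : x^-1 = u * (1 + p%:R * (- v))^-1.
  have E1 : 1 + p%:R * - v = u * x by rewrite -[X in X + _]E; ring.
  have u0 : u != 0.
    apply/eqP=> u0; have := local_one_add_neq0 sigma_inj bI p_prime Aw.
    by rewrite E1 u0 mul0r eqxx.
  rewrite E1.
  by rewrite invfM mulrA mulfV // mul1r.
by apply: localM => //; apply: (local_one_add sigma_inj bI).
Qed.

(** The products e_i of all P j with j <> i are linearly independent in O / p, a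
    vector space of dimension n over F_p: if p divides a combination of them
    with coefficient d_j prime to p at e_j, then P j divides d_j e_j, because it
    divides p and all other e_i; this is impossible for a prime element that
    divides no factor of e_j. *)
Lemma local_irred_bound (m : nat) (P : 'I_m -> F) :
  (forall i, local_irred (P i)) -> (forall i j, i != j -> ~ A (P j / P i)) -> (m <= n)%N.
Proof.
move=> irrP nassoc; rewrite leqNgt; apply/negP=> nm.
have IP i : is_integer (P i) /\ P i != 0 by case: (irrP i) => -[].
have [f Hf] := residue_classes bI (prime_gt0 p_prime).
pose e i := \prod_(j | j != i) P j.
have Ie i : is_integer (e i) by apply: is_integer_prod => j _; case: (IP j).
pose g (c : {ffun 'I_m -> 'I_p}) := \sum_i (c i)%:R * e i.
have Ig c : is_integer (g c).
  by apply: is_integer_sum => i _; apply: is_integerM => //; apply: is_integer_nat.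
have : ~~ injectiveb (fun c => f (g c)).
  apply/negP=> /injectiveP/leq_card; rewrite !card_ffun !card_ord leqNgt.
  by rewrite ltn_exp2l ?prime_gt1 // nm.
case/injectivePn=> c [c' cc' Ec].
have Ap : A ((g c - g c') / p%:R) by apply: integer_local => //; apply: Hf.
have [j cj] : exists j, c j != c' j.
  apply/existsP; move: cc'; apply: contraR; rewrite negb_exists => /forallP H.
  by apply/eqP/ffunP=> j; apply/eqP; have := H j; rewrite negbK.
have Pj0 : P j != 0 by case: (IP j).
have pF0 := p_neq0 F p_prime.
pose d : int := (c j)%:Z - (c' j)%:Z.
have pd : ~~ (p %| `|d|)%N.
  move: cj (ltn_ord (c j)) (ltn_ord (c' j)); rewrite -val_eqE /= /d.
  move: (c j : nat) (c' j : nat) => s t st sp tp; apply/negP=> /dvdn_leq H.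
  by have := H ltac:(lia); lia.
have Aother i : i != j -> A (e i / P j).
  move=> ij; rewrite /e (bigD1 j) 1?eq_sym //= mulrC mulrA mulVf // mul1r.
  by apply: local_prod => // k _; apply: integer_local => //; case: (IP k).
have : A (e j / P j).
  have -> : e j / P j = d%:~R^-1 * (d%:~R * e j / P j).
    rewrite !mulrA mulVf ?mul1r // -(rmorph_int (in_alg F)) fmorph_eq0 intr_eq0.
    by apply: contra pd => /eqP->.
  apply: localM => //; first exact: local_intV.
  have -> : d%:~R * e j / P j = (g c - g c') / p%:R * (p%:R / P j) -
      \sum_(i | i != j) ((c i)%:R - (c' i)%:R) * (e i / P j).
    rewrite mulrA divfK // /g -sumrB (bigD1 j) //= -mulrBl mulrDl.
    have -> : d%:~R = (c j)%:R - (c' j)%:R :> F by rewrite rmorphB.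
    rewrite [X in _ + X - _]mulr_suml -addrA -sumrB big1 ?addr0 // => i _.
    by rewrite -mulrBl mulrA subrr.
  apply: localB => //; first by apply: localM => //; apply: local_irred_dvd_p.
  apply: local_sum => // i ij; apply: localM => //; last exact: Aother.
  by apply: localB => //; apply: local_nat.
rewrite /e -big_filter => H.
have [|i] := local_irred_prod (irrP j) _ H; first by move=> i _; apply: IP.
by rewrite mem_filter => /andP[ij _]; apply: nassoc; rewrite eq_sym.
Qed.

Lemma logn_norm_split (m : nat) x y z : ~~ (p %| m)%N ->
  [/\ is_integer x, is_integer z & is_integer y] -> [/\ x != 0, z != 0 & y != 0] ->
  m%:R * x = z * y -> logn p (N x) = (logn p (N z) + logn p (N y))%N.
Proof.
move=> pm [Ix Iz Iy] [x0 z0 y0] E.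
have Ngt w : is_integer w -> w != 0 -> (0 < N w)%N by apply: (abs_norm_gt0 sigma_inj bI).
have m0 : (0 < m ^ n)%N.
  by rewrite expn_gt0 lt0n; apply/orP; left; apply: contra pm => /eqP->; apply: dvdn0.
rewrite -lognM ?Ngt // -(abs_normM sigma_inj bI) // -E.
rewrite (abs_normM sigma_inj bI) ?abs_norm_nat //; last exact: is_integer_nat.
by rewrite lognM ?Ngt // lognX (@logn_coprime p m) ?muln0 // prime_coprime.
Qed.

Lemma logn_nonunit_gt0 x : local_nonunit x -> (0 < logn p (N x))%N.
Proof.
move=> [Ix x0 px]; rewrite logn_gt0 mem_primes p_prime px andbT.
exact: (abs_norm_gt0 sigma_inj bI).
Qed.

Lemma local_irred_divisor x : local_nonunit x -> exists2 y, local_irred y & A (x / y).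
Proof.
have [k] := ubnP (logn p (N x)); elim: k x => // k IH x xk nux.
case: (pselect (local_irred x)) => [irrx|nirr].
  by exists x => //; case: nux => _ x0 _; rewrite mulfV //; apply: local1.
have [y [nuy Axy nAyx]] : exists y, [/\ local_nonunit y, A (x / y) & ~ A (y / x)].
  apply: contrapT => H; apply: nirr; split=> // y nuy Axy; apply: contrapT => nA.
  by apply: H; exists y.
have [Ix x0 px] := nux; have [Iy y0 py] := nuy.
have xy0 : x / y != 0 by rewrite mulf_neq0 ?invr_eq0.
have [m [pm Iz z0]] := local_to_integer Axy xy0.
set z := m%:R * (x / y) in Iz z0.
have E : m%:R * x = z * y by rewrite /z -mulrA divfK.
have pz : (p %| N z)%N.
  apply: contrapT => /negP pz; apply: nAyx.
  have Vz := local_unit sigma_inj bI p_prime Iz pz.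
  have -> : y / x = m%:R * z^-1.
    by rewrite /z invfM mulrA mulfV ?mul1r ?invf_div // (ndvd_neq0 F pm).
  by apply: localM => //; apply: local_nat.
have EL := logn_norm_split pm (And3 Ix Iz Iy) (And3 x0 z0 y0) E.
have lz : (0 < logn p (N z))%N by apply: logn_nonunit_gt0.
have lt : (logn p (N y) < k)%N.
  by rewrite -ltnS; apply: leq_trans xk; rewrite ltnS EL -add1n leq_add2r.
have [w irrw Ayw] := IH y lt nuy.
exists w => //; have -> : x / w = (x / y) * (y / w) by rewrite mulrA divfK.
exact: localM.
Qed.

(** A maximal list of pairwise non-associate irreducible elements. *)
Lemma local_primes : exists P : 'I_n -> F,
  (forall i, local_nonunit (P i)) /\
  forall x, local_nonunit x -> exists i, A (x / P i).
Proof.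
pose good (m : nat) := exists P : 'I_m -> F,
  (forall i, local_irred (P i)) /\ (forall i j, i != j -> ~ A (P j / P i)).
have good0 : exists m, `[< good m >].
  by exists 0%N; apply/asboolP; exists (fun=> 0); split; case.
have goodn m : `[< good m >] -> (m <= n)%N.
  by move/asboolP=> [P [irrP nP]]; apply: (local_irred_bound irrP nP).
case: (ex_maxnP good0 goodn) => m /asboolP[P [irrP nP]] mmax.
have mn := goodn m (asboolT (ex_intro _ P (conj irrP nP))).
have cover x : local_nonunit x -> exists i, A (x / P i).
  move=> nux; have [y irry Axy] := local_irred_divisor nux.
  have [[Iy y0 py] ymin] := irry.
  have [i Ayi] : exists i, A (y / P i).
    apply: contrapT => H.
    have : `[< good m.+1 >].
      apply/asboolP; exists (fun i => if unlift ord0 i is Some j then P j else y); split.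
        by move=> i; case: unliftP => [j|] _; [exact: irrP|exact: irry].
      move=> i j; case: unliftP => [i' ->|->]; case: unliftP => [j' ->|->].
      - by rewrite (inj_eq lift_inj) => ij; apply: nP.
      - move=> _ Ay; apply: H; exists i'; have [_ irri] := irrP i'.
        by apply: irri.
      - by move=> _ Ay; apply: H; exists j'.
      - by rewrite eqxx.
    by move/mmax; rewrite ltnn.
  exists i; have -> : x / P i = (x / y) * (y / P i) by rewrite mulrA divfK.
  exact: localM.
(* The list may be shorter than n; p itself is a harmless default. *)
exists (fun i : 'I_n => if insub (i : nat) is Some j then P j else p%:R); split.
  move=> i; case: insubP => [j _ _|_]; first by case: (irrP j).
  split; [exact: is_integer_nat|exact: p_neq0|].
  by rewrite abs_norm_nat dvdn_exp // adim_gt0.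
move=> x /cover[j Axj]; exists (widen_ord mn j).
by rewrite /= (insubT (fun k => (k < m)%N) (ltn_ord j)) /=;
  have -> : Sub (j : nat) (ltn_ord j) = j by apply: val_inj.
Qed.

(** Induction on the p-adic valuation of the norm, which drops when a P i is
    divided out. *)
Lemma local_factorization : exists P : 'I_n -> F, (forall i, P i != 0) /\
  forall x, is_integer x -> x != 0 -> exists e : 'I_n -> nat,
    [/\ A (x / \prod_i P i ^+ e i), A (\prod_i P i ^+ e i / x) &
        (\sum_i e i <= logn p (N x))%N].
Proof.
have [P [nuP cover]] := local_primes; exists P.
split=> [i|x]; first by case: (nuP i).
have [k] := ubnP (logn p (N x)); elim: k x => // k IH x xk Ix x0.
have P0 i : P i != 0 by case: (nuP i).
case: (boolP (p %| N x)%N) => px; last first.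
  exists (fun=> 0%N); rewrite big1 ?divr1 ?div1r => [|i _]; last by rewrite expr0.
  split; [exact: integer_local|exact: (local_unit sigma_inj bI)|].
  by rewrite big1.
have [i Axi] := cover x (And3 Ix x0 px).
have [Ii Pi0 pPi] := nuP i.
have xi0 : x / P i != 0 by rewrite mulf_neq0 ?invr_eq0.
have [m [pm Iz z0]] := local_to_integer Axi xi0.
set z := m%:R * (x / P i) in Iz z0.
have E : m%:R * x = z * P i by rewrite /z -mulrA divfK.
have EL := logn_norm_split pm (And3 Ix Iz Ii) (And3 x0 z0 Pi0) E.
have lP : (0 < logn p (N (P i)))%N by apply: logn_nonunit_gt0.
have lt : (logn p (N z) < k)%N.
  by rewrite -ltnS; apply: leq_trans xk; rewrite ltnS EL -addn1 leq_add2l.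
have [e [Aze Aez es]] := IH z lt Iz z0.
have mF0 := ndvd_neq0 F pm.
have Q0 : \prod_j P j ^+ e j != 0 by apply/prodf_neq0 => j _; rewrite expf_neq0.
exists (fun j => (e j + (j == i))%N).
have -> : \prod_j P j ^+ (e j + (j == i)) = P i * \prod_j P j ^+ e j.
  rewrite (eq_bigr (fun j => P j ^+ e j * P j ^+ (j == i))) => [|j _];
    last by rewrite exprD.
  rewrite big_split /= mulrC; congr (_ * _).
  by rewrite (bigD1 i) //= eqxx big1 ?mulr1 // => j /negPf->.
split.
- apply: (local_natVl pm); have -> : m%:R * (x / (P i * \prod_j P j ^+ e j)) = z /
    \prod_j P j ^+ e j.
    by rewrite /z invfM !mulrA.
  by [].
- have -> : P i * \prod_j P j ^+ e j / x = m%:R * (\prod_j P j ^+ e j / z).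
    by rewrite /z; field; rewrite x0 Pi0.
  by apply: localM => //; apply: local_nat.
- rewrite big_split /= (bigD1 i) //= [X in (_ + X <= _)%N](bigD1 i) //= eqxx.
  rewrite [\sum_(j | j != i) (j == i : nat)]big1; last by move=> j /negPf->.
  by move: es lP; rewrite EL (bigD1 i) //=; clear; lia.
Qed.

End LocalFactor.

(** * Integers up to units *)

Lemma logn_prod_primes (s : seq nat) (f : nat -> nat) (q : nat) : uniq s ->
  all prime s -> prime q ->
  logn q (\prod_(p <- s) p ^ f p)%N = if q \in s then f q else 0%N.
Proof.
move=> us ps pq; elim: s us ps => [|p s IH] /=; first by rewrite big_nil logn1.
move=> /andP[pns us] /andP[pp ps]; rewrite big_cons.
have s0 : (0 < \prod_(p <- s) p ^ f p)%N.
  rewrite big_seq; apply: prodn_cond_gt0 => r rs.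
  by rewrite expn_gt0 prime_gt0 //; apply: (allP ps).
have p0 : (0 < p ^ f p)%N by rewrite expn_gt0 prime_gt0.
rewrite lognM // lognX logn_prime // IH // in_cons.
case: eqVneq => [->|_] /=; last by rewrite muln0.
by rewrite (negPf pns) muln1 addn0.
Qed.

Lemma prod_primes_logn (m : nat) : (0 < m)%N -> (\prod_(p <- primes m) p ^ logn p m = m)%N.
Proof.
move=> m0; rewrite [RHS]prod_prime_decomp // prime_decompE big_map.
by apply: eq_bigr.
Qed.

Lemma expnS_ge (q k : nat) : (q ^ k * (q + k) <= q.+1 ^ k * q)%N.
Proof.
elim: k => [|k IH]; first by rewrite addn0.
rewrite !expnS; apply: (@leq_trans (q.+1 * (q ^ k * (q + k))));
  last by rewrite -mulnA leq_mul2l IH orbT.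
by move: (q ^ k)%N => r; nia.
Qed.

Section Labels.
Variables (R : realType) (F : fieldExtType rat) (theta : F).
Let n := \dim {:F}.
Variable sigma : 'I_n -> {rmorphism F -> R}.
Hypothesis sigma_inj : injective (fun j => sigma j theta).
Variable b : n.-tuple F.
Hypothesis bI : integral_basis b.
Implicit Types x y : F.
Local Notation N := (abs_norm sigma).

(** The natural numbers m with m x integral form an ideal that is contained in
    no p Z. *)
Lemma local_global x : x != 0 -> (forall p, prime p -> local_int p x) -> is_integer x.
Proof.
move=> x0 Ax.
pose P m := `[< (0 < m)%N /\ is_integer (m%:R * x) >].
have exP : exists m, P m.
  have [m pm Im] := Ax 2 isT; exists m; apply/asboolP; split=> //.
  by rewrite lt0n; apply: contra pm => /eqP->.
case: (ex_minnP exP) => m /asboolP[m0 Im] mmin.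
case: (ltngtP m 1) => [|m1|Em]; [by case: m m0 {Im mmin}| |by rewrite Em mul1r in Im].
have pp := pdiv_prime m1; have [k pk Ik] := Ax _ pp.
have [u [v E]] := Bezoutz m k.
have Ig : is_integer ((gcdn m k)%:R * x).
  have -> : (gcdn m k)%:R = u%:~R * m%:R + v%:~R * k%:R :> F.
    by have /(congr1 (fun z : int => z%:~R : F)) := E; rewrite rmorphD !rmorphM /= => ->.
  rewrite mulrDl -!mulrA; apply: is_integerD; apply: is_integerM => //;
    exact: is_integer_int.
have g0 : (0 < gcdn m k)%N by rewrite gcdn_gt0 m0.
have /mmin mg : P (gcdn m k) by apply/asboolP.
case/negP: pk; apply: dvdn_trans (pdiv_dvd m) _.
have -> : m = gcdn m k.
  by apply/eqP; rewrite eqn_leq mg dvdn_leq // dvdn_gcdl.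
exact: dvdn_gcdr.
Qed.

(** The j-th label of x is the product over p of p^(e_j), where e_j is the
    exponent of the j-th local prime at p in x. All exponents can be read off
    the labels, and they determine x up to local units at every p. *)
Lemma ideal_labels : exists L : F -> 'I_n -> nat,
  (forall x, is_integer x -> x != 0 ->
     (forall j, 0 < L x j)%N /\ (\prod_j L x j <= N x)%N) /\
  (forall x y, is_integer x -> x != 0 -> is_integer y -> y != 0 ->
     L x =1 L y -> is_integer (x / y)).
Proof.
have HP p : exists P : 'I_n -> F, prime p -> (forall i, P i != 0) /\
  forall x, is_integer x -> x != 0 -> exists e : 'I_n -> nat,
    [/\ local_int p (x / \prod_i P i ^+ e i), local_int p (\prod_i P i ^+ e i / x) &
        (\sum_i e i <= logn p (N x))%N].
  case: (boolP (prime p)) => [pp|_]; last by exists (fun=> 0).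
  by have [P HP] := local_factorization sigma_inj bI pp; exists P.
have [P {}HP] := choice HP.
have He (px : nat * F) : exists e : 'I_n -> nat, let: (p, x) := px in
    prime p -> is_integer x -> x != 0 ->
    [/\ local_int p (x / \prod_i P p i ^+ e i), local_int p (\prod_i P p i ^+ e i / x) &
        (\sum_i e i <= logn p (N x))%N].
  case: px => p x; case: (pselect [/\ prime p, is_integer x & x != 0]) => [[pp Ix x0]|H].
    by have [e He] := proj2 (HP p pp) x Ix x0; exists e.
  by exists (fun=> 0%N) => pp Ix x0; case: H.
have [e0 {}He] := choice He.
pose e p x := e0 (p, x).
have {}He p x : prime p -> is_integer x -> x != 0 ->
    [/\ local_int p (x / \prod_i P p i ^+ e p x i), local_int p (\prod_i P p i ^+ e p x i
      / x) &
        (\sum_i e p x i <= logn p (N x))%N] by apply: (He (p, x)).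
have N0 x : is_integer x -> x != 0 -> (0 < N x)%N by apply: (abs_norm_gt0 sigma_inj bI).
exists (fun x j => \prod_(p <- primes (N x)) p ^ e p x j)%N; split.
  move=> x Ix x0; split=> [j|].
    rewrite big_seq; apply: prodn_cond_gt0 => p; rewrite mem_primes => /andP[pp _].
    by rewrite expn_gt0 prime_gt0.
  rewrite exchange_big /= -[X in (_ <= X)%N](prod_primes_logn (N0 x Ix x0)) big_seq [X in
    (_ <= X)%N]big_seq.
  apply: leq_prod => p; rewrite mem_primes => /andP[pp _].
  by rewrite -expn_sum leq_exp2l ?prime_gt1 //; have [_ _] := He p x pp Ix x0.
have eE x p j : is_integer x -> x != 0 -> prime p ->
    logn p (\prod_(q <- primes (N x)) q ^ e q x j)%N = e p x j.
  move=> Ix x0 pp; rewrite (logn_prod_primes (fun q => e q x j)) ?primes_uniq //;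
    last first.
    by apply/allP=> q; rewrite mem_primes => /andP[].
  case: ifP => // pNx; have [_ _ le] := He p x pp Ix x0.
  have l0 : logn p (N x) = 0%N by apply/eqP; rewrite -leqn0 leqNgt logn_gt0 pNx.
  rewrite l0 (bigD1 j) //= leqn0 addn_eq0 in le.
  by case/andP: le => /eqP->.
move=> x y Ix x0 Iy y0 Exy; apply: local_global; first by rewrite mulf_neq0 ?invr_eq0.
move=> p pp; have [Ax Ax' _] := He p x pp Ix x0; have [Ay Ay' _] := He p y pp Iy y0.
have Ee : \prod_i P p i ^+ e p x i = \prod_i P p i ^+ e p y i.
  by apply: eq_bigr => i _; rewrite -(eE x) // -(eE y) // Exy.
set Q := \prod_i P p i ^+ e p y i in Ay Ay' *; rewrite Ee in Ax Ax'.
have Q0 : Q != 0.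
  by apply/prodf_neq0 => i _; rewrite expf_neq0 //; have [P0 _] := HP p pp.
have -> : x / y = (x / Q) * (Q / y) by rewrite mulrA divfK.
exact: localM.
Qed.

End Labels.

(** * Integers up to squares of totally positive units *)

Section Units.
Variables (R : realType) (F : fieldExtType rat) (theta : F).
Let n := \dim {:F}.
Variable sigma : 'I_n -> {rmorphism F -> R}.
Hypothesis sigma_inj : injective (fun j => sigma j theta).
Variable b : n.-tuple F.
Hypothesis bI : integral_basis b.
Implicit Types x y : F.
Local Notation N := (abs_norm sigma).

Definition pos_unit x := [/\ is_integer x, is_integer x^-1 & forall j, 0 < sigma j x].

Lemma pos_unit1 : pos_unit 1.
Proof. by split=> [||j]; rewrite ?invr1; try exact: is_integer1; rewrite rmorph1. Qed.

Lemma pos_unit_neq0 x : pos_unit x -> x != 0.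
Proof.
move=> [_ _ px]; apply/eqP=> x0; have := px (Ordinal (adim_gt0 {:F}%AS)).
by rewrite x0 rmorph0 ltxx.
Qed.

Lemma pos_unitM x y : pos_unit x -> pos_unit y -> pos_unit (x * y).
Proof.
move=> [Ix Vx px] [Iy Vy py]; split=> [||j]; rewrite ?invfM; try exact: is_integerM.
by rewrite rmorphM mulr_gt0.
Qed.

Lemma pos_unitV x : pos_unit x -> pos_unit x^-1.
Proof.
by move=> [Ix Vx px]; split=> [||j]; rewrite ?invrK // fmorphV invr_gt0.
Qed.

Lemma integer_small_eq0 x : is_integer x -> (forall j, `|sigma j x| < 1) -> x = 0.
Proof.
move=> Ix sx; apply/eqP; apply: contraT => x0.
have H1 : \prod_j `|sigma j x| < \prod_(j < n) 1.
  apply: ltr_prod => [|j _]; last by rewrite normr_ge0 sx.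
  by apply/hasP; exists (Ordinal (adim_gt0 {:F}%AS)); rewrite ?mem_index_enum.
rewrite big1_eq -normr_prod -(abs_normE sigma_inj bI) // -[1]/(1%:R) ltr_nat ltnS leqn0
  in H1.
by have := abs_norm_gt0 sigma_inj bI Ix x0; rewrite (eqP H1).
Qed.

Lemma pos_unit_ratio x y : pos_unit x -> pos_unit y ->
  (forall j, sigma j x < 2 * sigma j y) -> x = y.
Proof.
move=> ux uy lt; have [Ix Vx px] := ux; have [Iy Vy py] := uy.
have y0 := pos_unit_neq0 uy.
apply/eqP; rewrite -subr_eq0; apply/eqP.
have : x / y - 1 = 0.
  apply: integer_small_eq0 => [|j].
    by apply: is_integerB; [apply: is_integerM|exact: is_integer1].
  rewrite rmorphB rmorph1 fmorph_div.
  have r0 : 0 < sigma j x / sigma j y by rewrite divr_gt0.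
  have r2 : sigma j x / sigma j y < 2 by rewrite ltr_pdivrMr.
  by rewrite ltr_norml; move: (sigma j x / sigma j y) r0 r2 => r r0 r2; apply/andP;
    split; lra.
move/eqP; rewrite subr_eq0 => /eqP E.
by rewrite -[x](divfK y0) E mul1r subrr.
Qed.

Lemma dyadic_cell (C : nat) (y : R) : 2 ^- C < y < 2 ^+ C ->
  exists t : 'I_(2 * C).+1, 2 ^+ t <= y * 2 ^+ C < 2 ^+ t.+1.
Proof.
move=> /andP[lo hi].
pose P t := 2 ^+ t <= y * 2 ^+ C.
have P0 : exists t, P t.
  by exists 0%N; rewrite /P expr0 -ler_pdivrMr ?exprn_gt0 // mul1r ltW.
have Pm t : P t -> (t <= 2 * C)%N.
  rewrite /P => le; have : 2 ^+ t < 2 ^+ (2 * C) :> R.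
    apply: le_lt_trans le _; rewrite mul2n -addnn exprD ltr_pM2r ?exprn_gt0 //.
  by rewrite ltr_eXn2l ?ltr1n // => /ltnW.
case: (ex_maxnP P0 Pm) => t Pt tmax.
have lt : (t < (2 * C).+1)%N by rewrite ltnS Pm.
exists (Ordinal lt); rewrite [X in X && _]Pt /= ltNge; apply/negP=> /tmax.
by rewrite ltnn.
Qed.

(** Two totally positive units in the same dyadic cell have a ratio u with |u -
    1| < 1 at every place, so the norm of u - 1 is less than 1, and u = 1. *)
Lemma pos_units_bound (I : finType) (C : nat) (u : I -> F) : injective u ->
  (forall i, pos_unit (u i)) -> (forall i j, 2 ^- C < sigma j (u i) < 2 ^+ C) ->
  (#|I| <= (2 * C).+1 ^ n)%N.
Proof.
move=> uinj upos ub.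
have H i : exists t : 'I_n -> 'I_(2 * C).+1, forall j,
    2 ^+ t j <= sigma j (u i) * 2 ^+ C < 2 ^+ (t j).+1.
  by have [t Ht] := choice (fun j => dyadic_cell (ub i j)); exists t.
have [t Ht] := choice H.
suff tinj : injective (fun i => [ffun j => t i j]).
  by have := leq_card _ tinj; rewrite card_ffun !card_ord.
move=> i k /ffunP Etk; apply: uinj; apply: pos_unit_ratio => // j.
have E : t i j = t k j by have := Etk j; rewrite !ffunE.
have /andP[_ h1] := Ht i j; have /andP[h2 _] := Ht k j.
rewrite -(ltr_pM2r (_ : 0 < 2 ^+ C)) ?exprn_gt0 //.
by apply: lt_le_trans h1 _; rewrite E exprS -mulrA ler_pM2l.
Qed.

Definition dyadic_range (E : nat) (y : R) := 2 ^- E <= y <= 2 ^+ E.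

Lemma dyadic_range1 : dyadic_range 0 1.
Proof. by rewrite /dyadic_range expr0 invr1 lexx. Qed.

Lemma dyadic_rangeM (E E' : nat) (y y' : R) : dyadic_range E y -> dyadic_range E' y' ->
  dyadic_range (E + E') (y * y').
Proof.
rewrite /dyadic_range => /andP[l h] /andP[l' h'].
have p0 k : 0 <= 2 ^- k :> R by rewrite invr_ge0 exprn_ge0.
rewrite exprD invfM; apply/andP; split; first exact: ler_pM.
by apply: ler_pM => //; apply: le_trans (p0 _) _; eassumption.
Qed.

(** u_(i_1) u_(i_2)^2 u_(i_3)^4 and so on. *)
Fixpoint tower (m : nat) (u : 'I_m -> F) (s : seq 'I_m) : F :=
  if s is i :: s' then u i * tower u s' ^+ 2 else 1.

(** The tower of a sequence determines it: its first term is known from the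
    class modulo squares, and square roots of positive elements are unique. So k
    indices chosen among m > 2^n give m^k units, of size between 2^-C and 2^C at
    each place with C = c 2^k; but by [pos_units_bound] there are at most (3
    C)^n of these, which is O(2^(n k)). *)
Lemma unit_square_classes (m : nat) (u : 'I_m -> F) :
  (forall i, pos_unit (u i)) ->
  (forall i j, i != j -> ~ exists2 v, pos_unit v & u i = u j * v ^+ 2) ->
  (m <= 2 ^ n)%N.
Proof.
move=> upos unsq; rewrite leqNgt; apply/negP=> qm; set q := (2 ^ n)%N in qm.
have tpos s : pos_unit (tower u s).
  elim: s => [|i s IH] /=; first exact: pos_unit1.
  by rewrite expr2; do 2!apply: pos_unitM => //.
have [c [c0 Hc]] : exists c : nat, (0 < c)%N /\ forall i j, 2 ^- c <= sigma j (u i) <= 2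
  ^+ c.
  pose B i j := (Num.bound (sigma j (u i)) + Num.bound (sigma j (u i))^-1)%N.
  pose c := (\sum_i \sum_j B i j).+1; exists c; split=> // i j.
  have [_ _ /(_ j) y0] := upos i.
  have Bc : (B i j <= c)%N.
    rewrite /c (bigD1 i) //= (bigD1 j) //= ltnW // ltnS.
    by apply: leq_trans (leq_addr _ _); apply: leq_addr.
  have h1 : sigma j (u i) < 2 ^+ c.
    by apply: upper_nthrootP; apply: leq_trans Bc; apply: leq_addr.
  have h2 : (sigma j (u i))^-1 < 2 ^+ c.
    by apply: upper_nthrootP; apply: leq_trans Bc; apply: leq_addl.
  by rewrite (ltW h1) andbT -[sigma j _]invrK lef_pV2 ?posrE ?invr_gt0 ?exprn_gt0 ?ltW.
have tinj k : injective (fun s : k.-tuple 'I_m => tower u s).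
  elim: k => [|k IH] s t; first by rewrite (tuple0 s) (tuple0 t).
  case/tupleP: s => i s; case/tupleP: t => j t /= E.
  have [s0 t0] := (pos_unit_neq0 (tpos s), pos_unit_neq0 (tpos t)).
  have Eij : i = j.
    apply/eqP; apply: contraT => ij; case: (unsq i j ij).
    exists (tower u t / tower u s); last first.
      by rewrite expr_div_n mulrA -E mulfK // expf_neq0.
    by apply: pos_unitM; [|apply: pos_unitV].
  move: E; rewrite Eij => /(mulfI (pos_unit_neq0 (upos j))) E.
  suff /IH -> : tower u s = tower u t by [].
  have [_ _ ps] := tpos s; have [_ _ pt] := tpos t.
  move/eqP: E; rewrite eqf_sqr => /orP[/eqP //|/eqP E].
  have := ps (Ordinal (adim_gt0 {:F}%AS)); rewrite E rmorphN oppr_gt0 => h.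
  by have := pt (Ordinal (adim_gt0 {:F}%AS)); rewrite ltNge (ltW h).
have tb k (s : k.-tuple 'I_m) j : 2 ^- (c * 2 ^ k) < sigma j (tower u s) < 2 ^+ (c * 2 ^ k).
  have : dyadic_range (c * (2 ^ k).-1) (sigma j (tower u s)).
    elim: k s => [|k IH] s.
      by rewrite (tuple0 s) /= muln0 rmorph1; apply: dyadic_range1.
    case/tupleP: s => i s /=; rewrite rmorphM rmorphXn /= expr2.
    have -> : (c * (2 ^ k.+1).-1 = c + (c * (2 ^ k).-1 + c * (2 ^ k).-1))%N.
      by rewrite expnS; have : (0 < 2 ^ k)%N by [rewrite expn_gt0]; move: (2 ^ k)%N => w;
        nia.
    by apply: dyadic_rangeM; [exact: Hc|apply: dyadic_rangeM; apply: IH].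
  have lt : (c * (2 ^ k).-1 < c * 2 ^ k)%N by rewrite ltn_pmul2l // prednK ?expn_gt0.
  move=> /andP[lo hi]; apply/andP; split.
    by apply: lt_le_trans lo; rewrite ltf_pV2 ?posrE ?exprn_gt0 // ltr_eXn2l ?ltr1n.
  by apply: le_lt_trans hi _; rewrite ltr_eXn2l ?ltr1n.
have bnd k : (m ^ k <= (2 * (c * 2 ^ k)).+1 ^ n)%N.
  have := pos_units_bound (@tinj k) (fun s => tpos s) (@tb k).
  by rewrite card_tuple card_ord.
pose K := ((3 * c) ^ n)%N.
have bnd2 k : (q.+1 ^ k <= K * q ^ k)%N.
  apply: (@leq_trans (m ^ k)); first by case: k => // k; rewrite leq_exp2r.
  apply: leq_trans (bnd k) _; rewrite /K /q.
  have -> : ((3 * c) ^ n * (2 ^ n) ^ k = (3 * c * 2 ^ k) ^ n)%N.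
    by rewrite [RHS]expnMn -!expnM [(k * n)%N]mulnC.
  have : (0 < c * 2 ^ k)%N by rewrite muln_gt0 c0 expn_gt0.
  rewrite leq_exp2r ?adim_gt0 //; move: (2 ^ k)%N => w; nia.
have q0 : (0 < q)%N by rewrite expn_gt0.
(* At k = K q, Bernoulli's inequality gives (q + 1)^k >= (K + 1) q^k. *)
have := expnS_ge q (K * q); have := bnd2 (K * q)%N.
have : (0 < q ^ (K * q))%N by rewrite expn_gt0 q0.
move: (q.+1 ^ (K * q))%N (q ^ (K * q))%N => A B B0 AB BA.
have : (B * (q + K * q) <= K * B * q)%N by apply: leq_trans BA _; rewrite leq_mul2r AB orbT.
by move: B0 q0; nia.
Qed.

Definition square_equiv x y := exists2 v, pos_unit v & x = y * v ^+ 2.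

(** The labels of [ideal_labels] are tuples of product at most X, and elements
    with the same labels differ by totally positive units. *)
Lemma square_class_count (X m : nat) (x : 'I_m -> F) :
  (forall i, [/\ is_integer (x i), forall j, 0 < sigma j (x i) & (N (x i) <= X)%N]) ->
  (forall i j, i != j -> ~ square_equiv (x i) (x j)) ->
  (m <= 2 ^ n * #|tuples_le n X|)%N.
Proof.
move=> Hx nsq; have [L [HL Linj]] := ideal_labels sigma_inj bI.
have x0 i : x i != 0.
  have [_ px _] := Hx i; apply/eqP=> x0; have := px (Ordinal (adim_gt0 {:F}%AS)).
  by rewrite x0 rmorph0 ltxx.
have Lle i j : (L (x i) j < X.+1)%N.
  have [Ix _ NX] := Hx i; have [L0 LN] := HL _ Ix (x0 i).
  rewrite ltnS; apply: leq_trans NX; apply: leq_trans LN.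
  rewrite (bigD1 j) //= leq_pmulr //; by apply: prodn_cond_gt0.
pose l i : {ffun 'I_n -> 'I_X.+1} := [ffun j => Ordinal (Lle i j)].
have lT i : l i \in tuples_le n X.
  have [Ix _ NX] := Hx i; have [L0 LN] := HL _ Ix (x0 i).
  rewrite inE; apply/andP; split; first by apply/forallP=> j; rewrite ffunE; apply: L0.
  by apply: leq_trans NX; rewrite (eq_bigr (L (x i))) // => j _; rewrite ffunE.
rewrite -[X in (X <= _)%N](card_ord m) -[X in (X <= _)%N]sum1_card (partition_big l (mem
  (tuples_le n X))) //=.
rewrite mulnC -sum_nat_const; apply: leq_sum => f _.
rewrite sum1_card; set Y := [pred i | l i == f].
have [->|/card_gt0P[i0 Yi0]] := posnP #|Y|; first by [].
pose u (k : 'I_#|Y|) := x (enum_val k) / x i0.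
have inY k : l (enum_val (k : 'I_#|Y|)) = l i0.
  by have := enum_valP k; rewrite !inE => /eqP->; have := Yi0; rewrite !inE => /eqP->.
have Leq i j : l i = l j -> is_integer (x i / x j).
  move=> Eij; have [Ii _ _] := Hx i; have [Ij _ _] := Hx j; apply: Linj => // k.
  by have /ffunP/(_ k)/(congr1 val) := Eij; rewrite !ffunE.
apply: (@unit_square_classes _ u) => [k|k k' kk'].
  have [_ pk _] := Hx (enum_val k); have [_ p0 _] := Hx i0.
  split=> [||j]; rewrite /u ?invf_div; try exact: Leq.
  by rewrite fmorph_div divr_gt0.
move=> [v pv E]; apply: (nsq (enum_val k) (enum_val k')).
  by rewrite (inj_eq enum_val_inj).
exists v => //; apply: (mulIf (invr_neq0 (x0 i0))).
by rewrite -/(u k) E /u mulrAC.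
Qed.

End Units.

(** * Trace forms *)

Section TraceForms.
Variables (R : realType) (F : fieldExtType rat) (theta : F).
Let n := \dim {:F}.
Variable sigma : 'I_n -> {rmorphism F -> R}.
Hypothesis sigma_inj : injective (fun j => sigma j theta).
Variable b : n.-tuple F.
Hypothesis bI : integral_basis b.
Let bB : basis_of {:F} b := integral_basis_basis erefl bI.
Let j0 : 'I_n := Ordinal (adim_gt0 {:F}%AS).
Implicit Types x y : F.
Local Notation N := (abs_norm sigma).
Local Notation Delta := (\det (embed_mx sigma b) ^+ 2).

Lemma sigma_gt0_neq0 x : (forall j, 0 < sigma j x) -> x != 0.
Proof. by move=> px; apply/eqP=> x0; have := px j0; rewrite x0 rmorph0 ltxx. Qed.

Lemma ratr_inj : injective (ratr : rat -> R).
Proof. exact: fmorph_inj. Qed.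

(** The form Tr (beta x^2) is positive definite, and its determinant in an
    integral basis is N(beta) times the discriminant. The q i are the terms of
    its diagonalization. *)
Lemma trace_form_sections (beta : F) : (forall j, 0 < sigma j beta) ->
  exists q : 'I_n -> F -> rat,
    [/\ forall i x, 0 <= q i x, forall i x, q i (- x) = q i x,
        forall x, ratr (\sum_i q i x) = \sum_j sigma j (beta * x ^+ 2) &
        forall tau : 'I_n -> rat, (forall i, 0 < tau i) ->
          \prod_j sigma j beta * Delta <= ratr (\prod_i tau i) ->
          exists x, [/\ is_integer x, x != 0 & forall i, q i x <= tau i]].
Proof.
move=> pbeta.
pose V := embed_mx sigma b.
pose G : 'M[rat]_n := \matrix_(i, j) field_trace (beta * b`_i * b`_j).
pose crd x : 'rV[rat]_n := \row_i coord b i x.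
have EG : map_mx ratr G = V *m diag_mx (\row_j sigma j beta) *m V^T.
  apply/matrixP=> i j; rewrite mul_mx_diag !mxE (field_trace_embed sigma_inj).
  by apply: eq_bigr => k _; rewrite !mxE !rmorphM [sigma k beta * _]mulrC.
have crdV x : map_mx ratr (crd x) *m V = \row_j sigma j x.
  apply/rowP=> j; rewrite !mxE (embed_coord sigma x j bB).
  by apply: eq_bigr => i _; rewrite !mxE.
have EQ x : ratr ((crd x *m G *m (crd x)^T) 0 0) = \sum_j sigma j (beta * x ^+ 2).
  have -> : ratr ((crd x *m G *m (crd x)^T) 0 0) =
      (map_mx ratr (crd x *m G *m (crd x)^T) : 'M[R]_1) 0 0 by rewrite [RHS]mxE.
  rewrite !map_mxM -map_trmx EG !mulmxA crdV -[_ *m V^T *m _]mulmxA -trmx_mul crdV.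
  rewrite mul_mx_diag mxE; apply: eq_bigr => j _.
  by rewrite !mxE rmorphM rmorphXn expr2; ring.
have Gsym : G^T = G.
  by apply/matrixP=> i j; rewrite !mxE; congr field_trace; ring.
have crdK (v : 'rV[rat]_n) : crd (\sum_i v 0 i *: b`_i) = v.
  by apply/rowP=> i; rewrite mxE (coord_sum_free _ _ (basis_free bB)).
have Gpos (v : 'rV_n) : v != 0 -> 0 < (v *m G *m v^T) 0 0.
  move=> v0; set y := \sum_i v 0 i *: b`_i.
  have y0 : y != 0.
    apply: contra v0 => /eqP y0; rewrite -[v]crdK -/y y0.
    by apply/eqP/rowP=> i; rewrite !mxE linear0.
  rewrite -(ltr_rat R) rmorph0 -[v]crdK -/y EQ.
  rewrite (bigD1 j0) //= ltr_wpDr ?sumr_ge0 // => [j _|].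
    by rewrite rmorphM rmorphXn mulr_ge0 ?sqr_ge0 // ltW.
  by rewrite rmorphM rmorphXn mulr_gt0 // lt_neqAle sqr_ge0 eq_sym sqrf_eq0 fmorph_eq0 y0.
have [U [D [Ut U1 D0 ELDL]]] := ldl_decomposition Gsym Gpos.
exists (fun i x => D 0 i * (crd x *m U) 0 i ^+ 2); split.
- by move=> i x; rewrite mulr_ge0 ?sqr_ge0 // ltW.
- move=> i x; have -> : crd (- x) = - crd x by apply/rowP=> k; rewrite !mxE linearN.
  by rewrite mulNmx [X in _ * X ^+ 2 = _]mxE sqrrN.
- move=> x; rewrite -EQ ELDL; congr ratr.
  rewrite !mulmxA -[_ *m U^T *m _]mulmxA -trmx_mul mul_mx_diag mxE.
  by apply: eq_bigr => i _; rewrite !mxE; ring.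
move=> tau tau0 Htau.
have detG : \prod_i D 0 i <= \prod_i tau i.
  rewrite -(ler_rat R); apply: le_trans Htau.
  have -> : \prod_i D 0 i = \det G.
    rewrite ELDL !det_mulmx det_tr det_diag det_trig //.
    by rewrite [X in X * _ * X]big1 ?mul1r ?mulr1.
  rewrite -(det_map_mx (ratr : {rmorphism rat -> R})) EG !det_mulmx det_tr det_diag.
  rewrite mulrAC -expr2 mulrC le_eqVlt; apply/orP; left; apply/eqP.
  by congr (_ * _); apply: eq_bigr => j _; rewrite mxE.
have [c c0 Hc] := short_vector (adim_gt0 {:F}%AS) Ut U1 D0 tau0 detG.
have Ec : crd (\sum_i (c 0 i)%:~R *: b`_i) = map_mx intr c.
  by rewrite -[RHS]crdK; congr crd; apply: eq_bigr => i _; rewrite mxE.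
exists (\sum_i (c 0 i)%:~R *: b`_i); split.
- apply: is_integer_sum => i _; rewrite scaler_int; apply: is_integerMz.
  by case: bI => bint _; have := bint i; rewrite (tnth_nth 0).
- apply: contra c0 => /eqP E0; rewrite E0 in Ec; apply/eqP/rowP=> i.
  have /rowP/(_ i) := Ec; rewrite !mxE linear0 => /eqP.
  by rewrite eq_sym intr_eq0 => /eqP.
by rewrite Ec.
Qed.

Lemma det_embed_sqr_gt0 : 0 < Delta.
Proof.
rewrite lt_neqAle sqr_ge0 eq_sym sqrf_eq0 andbT -unitfE -unitmxE.
exact: (embed_mx_unit sigma_inj bB).
Qed.

(** Use the form Tr (x^2 / h), of determinant at most (n + 1)^-n, with all
    weights equal to 1 / (n + 1): some x has Tr (x^2 / h) <= n / (n + 1) < 1,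
    and each of the positive terms sigma j (x^2 / h) is less than 1. *)
Lemma square_below (h : F) : is_integer h -> (forall j, 0 < sigma j h) ->
  (n.+1 ^ n)%N%:R * Delta <= (N h)%:R ->
  exists x, [/\ is_integer x, x != 0 & forall j, sigma j (x ^+ 2) < sigma j h].
Proof.
move=> Ih ph Nh; have h0 := sigma_gt0_neq0 ph.
have [|q [q0 _ qE /(_ (fun=> n.+1%:R^-1))]] := @trace_form_sections h^-1.
  by move=> j; rewrite fmorphV invr_gt0.
have n0 : 0 < n.+1%:R :> R by rewrite ltr0n.
case=> [i||x [Ix x0 Hx]]; first by rewrite invr_gt0 ltr0n.
  rewrite prodr_const card_ord rmorphXn fmorphV rmorph_nat.
  rewrite (abs_normE sigma_inj bI) // ger0_norm in Nh;
    last by rewrite prodr_ge0 // => j _; apply: ltW.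
  have P0 : 0 < \prod_j sigma j h by rewrite prodr_gt0.
  rewrite (eq_bigr (fun j => (sigma j h)^-1)) => [|j _]; last exact: fmorphV.
  rewrite prodfV mulrC ler_pdivrMr // exprVn mulrC ler_pdivlMr ?exprn_gt0 //.
  by rewrite mulrC -natrX.
exists x; split=> // j.
have lt1 : \sum_k sigma k (h^-1 * x ^+ 2) < 1.
  rewrite -qE -[X in _ < X](rmorph1 (ratr : {rmorphism rat -> R})) ltr_rat.
  apply: (@le_lt_trans _ _ (\sum_(i < n) n.+1%:R^-1)); first exact: ler_sum.
  by rewrite sumr_const card_ord -[_ *+ \dim _]mulr_natr mulrC ltr_pdivrMr ?ltr0n //
    mul1r ltr_nat.
have : sigma j (h^-1 * x ^+ 2) < 1.
  apply: le_lt_trans lt1; rewrite (bigD1 j) //= lerDl sumr_ge0 // => k _.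
  by rewrite rmorphM rmorphXn fmorphV mulr_ge0 ?sqr_ge0 // invr_ge0 ltW.
by rewrite rmorphM fmorphV mulrC ltr_pdivrMr // mul1r.
Qed.

End TraceForms.

(** * Lower bound for the discriminant *)

Section Discriminant.
Variables (R : realType) (F : fieldExtType rat) (theta : F).
Let n := \dim {:F}.
Variable sigma : 'I_n -> {rmorphism F -> R}.
Hypothesis sigma_inj : injective (fun j => sigma j theta).
Variable b : n.-tuple F.
Hypothesis bI : integral_basis b.
Let j0 : 'I_n := Ordinal (adim_gt0 {:F}%AS).
Implicit Types x y h : F.
Local Notation N := (abs_norm sigma).
Local Notation Delta := (\det (embed_mx sigma b) ^+ 2).

Definition int_trace x : nat := `|Num.floor (\sum_j sigma j x)|%N.

Lemma int_traceE x : is_integer x -> (forall j, 0 <= sigma j x) ->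
  (int_trace x)%:R = \sum_j sigma j x.
Proof.
move=> Ix px; have [A [_ _ Et]] := integer_mul_mx sigma_inj bI Ix.
have : 0 <= \sum_j sigma j x by apply: sumr_ge0.
rewrite /int_trace -Et intrKfloor ler0z natr_absz => h.
by rewrite ger0_norm.
Qed.

Lemma sigma_sqr_ge0 x j : 0 <= sigma j (x ^+ 2).
Proof. by rewrite rmorphXn sqr_ge0. Qed.

(** The trace of x^2 is an integer, so it is at most n, while the norm of x^2 is
    at least 1: this is the equality case of the inequality of arithmetic and
    geometric means. *)
Lemma trace_sqr_min x : is_integer x -> x != 0 ->
  \sum_j sigma j (x ^+ 2) < n.+1%:R -> x ^+ 2 = 1.
Proof.
move=> Ix x0; have Ix2 : is_integer (x ^+ 2) by apply: is_integerX.
have s0 := sigma_sqr_ge0 x.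
rewrite -int_traceE // ltr_nat ltnS -(ler_nat R) int_traceE // => tr_le.
have n0 : 0 < n%:R :> R by rewrite ltr0n adim_gt0.
have P1 : 1 <= \prod_j sigma j (x ^+ 2).
  rewrite -[X in _ <= X]ger0_norm ?prodr_ge0 // -(abs_normE sigma_inj bI) // ler1n.
  by apply: (abs_norm_gt0 sigma_inj bI); rewrite ?expf_neq0.
have [/= le1 eq1] := leif_AGM (A := [pred _ : 'I_n | true]) (fun i _ => s0 i).
rewrite cardT size_enum_ord in le1 eq1.
set mu := (_ / _) in le1 eq1.
have mu1 : mu <= 1 by rewrite ler_pdivrMr // mul1r.
have mu0 : 0 <= mu by rewrite divr_ge0 ?sumr_ge0 ?ltW.
have mun : mu ^+ n <= 1 by apply: exprn_ile1.
have : [forall i in [pred _ : 'I_n | true], forall j in [pred _ : 'I_n | true],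
    sigma i (x ^+ 2) == sigma j (x ^+ 2)].
  by rewrite -eq1 eq_le le1 (le_trans mun).
move=> /forall_inP H.
have Ej j : sigma j (x ^+ 2) = sigma j0 (x ^+ 2).
  by have /forall_inP/(_ j0 isT)/eqP := H j isT.
have : sigma j0 (x ^+ 2) = 1.
  apply/eqP; rewrite eq_le; apply/andP; split.
    move: tr_le; rewrite (eq_bigr (fun=> sigma j0 (x ^+ 2))) // sumr_const card_ord.
    by rewrite -[_ *+ _]mulr_natl -[X in _ <= X]mulr1 ler_pM2l.
  rewrite leNgt; apply/negP=> lt1; move: P1; rewrite (eq_bigr (fun=> sigma j0 (x ^+ 2))) //.
  by rewrite prodr_const card_ord leNgt exprn_ilt1 // -lt0n adim_gt0.
by rewrite -(rmorph1 (sigma j0)) => /fmorph_inj.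
Qed.

(** If the discriminant is 1, the trace form Tr (x^2) takes weights (a, 1 / a,
    1, ..., 1) with a = 2: some nonzero x has Tr (x^2) <= n + 1/2, so x = +-1 by
    [trace_sqr_min]. Therefore q i1 1 <= 1/2, and with a = 1/2 also q i0 1 <=
    1/2. As the other q i 1 are at most 1, this gives Tr 1 <= n - 1, a
    contradiction. *)
Lemma disc_neq1 : (1 < n)%N -> Delta != 1.
Proof.
move=> n1; apply/eqP=> D1.
have [|q [q0 qN qE Hq]] := trace_form_sections sigma_inj bI (beta := 1).
  by move=> j; rewrite rmorph1.
pose i0 : 'I_n := Ordinal (ltnW n1); pose i1 : 'I_n := Ordinal n1.
have i10 : i1 != i0 by [].
have split2 (f : 'I_n -> rat) :
    \sum_i f i = f i0 + (f i1 + \sum_(i | (i != i0) && (i != i1)) f i).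
  by rewrite (bigD1 i0) //= (bigD1 i1).
have rest : \sum_(i : 'I_n | (i != i0) && (i != i1)) (1 : rat) = n%:R - 2%:R.
  have := split2 (fun=> 1); rewrite sumr_const card_ord => ->; ring.
have run (a : rat) : 0 < a -> a + a^-1 < 3 ->
    [/\ q i0 1 <= a, q i1 1 <= a^-1 & forall i, i != i0 -> i != i1 -> q i 1 <= 1].
  move=> a0 a3; pose tau i := if i == i0 then a else if i == i1 then a^-1 else 1.
  have [i||x [Ix x0 Hx]] := Hq tau.
  - by rewrite /tau; case: ifP => // _; case: ifP => // _; rewrite invr_gt0.
  - rewrite big1 => [|j _]; last exact: rmorph1.
    rewrite D1 mulr1 (bigD1 i0) //= (bigD1 i1) //= big1 => [|i /andP[/negPf i0' /negPf
      i1']].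
      by rewrite /tau eqxx (negPf i10) eqxx mulr1 mulfV ?lt0r_neq0 // rmorph1.
    by rewrite /tau i0' i1'.
  have x2 : x ^+ 2 = 1.
    apply: trace_sqr_min => //; have := qE x; rewrite mul1r => <-.
    rewrite -(rmorph_nat (ratr : {rmorphism rat -> R})) ltr_rat.
    apply: (@le_lt_trans _ _ (\sum_i tau i)); first exact: ler_sum.
    rewrite split2 /tau eqxx (negPf i10) eqxx.
    have -> : \sum_(i | (i != i0) && (i != i1)) (if i == i0 then a else if i == i1 then
      a^-1 else 1) = n%:R - 2%:R.
      by rewrite -rest; apply: eq_bigr => i /andP[/negPf-> /negPf->].
    by rewrite -natr1; lra.
  have q1 i : q i x = q i 1.
    by move/eqP: x2; rewrite sqrf_eq1 => /orP[] /eqP->.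
  split=> [||i ii0 ii1]; rewrite -q1.
  - by have := Hx i0; rewrite /tau eqxx.
  - by have := Hx i1; rewrite /tau (negPf i10) eqxx.
  - by have := Hx i; rewrite /tau (negPf ii0) (negPf ii1).
have [||_ q11 _] := run 2; [by []|by lra|].
have [||q01 _ qi1] := run 2^-1; [by rewrite invr_gt0|by rewrite invrK; lra|].
have E1 : \sum_j sigma j (1 * 1 ^+ 2) = n%:R.
  rewrite (eq_bigr (fun=> 1)) => [|j _]; first by rewrite sumr_const card_ord.
  by rewrite expr1n mulr1 rmorph1.
have := qE 1; rewrite E1.
rewrite -(rmorph_nat (ratr : {rmorphism rat -> R})) => /ratr_inj.
have : \sum_(i | (i != i0) && (i != i1)) q i 1 <= n%:R - 2%:R.
  by rewrite -rest; apply: ler_sum => i /andP[]; apply: qi1.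
rewrite split2; move: q11 q01; lra.
Qed.
End Discriminant.

(** * Sums with few distinct summands *)

Section Decomposition.
Variables (R : realType) (F : fieldExtType rat) (theta : F).
Let n := \dim {:F}.
Variable sigma : 'I_n -> {rmorphism F -> R}.
Hypothesis sigma_inj : injective (fun j => sigma j theta).
Variable b : n.-tuple F.
Hypothesis bI : integral_basis b.
Let j0 : 'I_n := Ordinal (adim_gt0 {:F}%AS).
Implicit Types x y h : F.
Local Notation N := (abs_norm sigma).
Local Notation Delta := (\det (embed_mx sigma b) ^+ 2).

Definition pos_integer x := is_integer x /\ forall j, 0 < sigma j x.

Lemma pos_integer_trace x : pos_integer x ->
  (int_trace sigma x)%:R = \sum_j sigma j x /\ (0 < int_trace sigma x)%N.
Proof.
move=> [Ix px]; have E : (int_trace sigma x)%:R = \sum_j sigma j x.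
  by apply: (int_traceE sigma_inj bI) => // j; apply: ltW.
split=> //; rewrite -(ltr_nat R) E (bigD1 j0) //= ltr_wpDr //.
by apply: sumr_ge0 => j _; apply: ltW.
Qed.

Lemma pos_integer_neq0 x : pos_integer x -> x != 0.
Proof. by case=> _; apply: sigma_gt0_neq0. Qed.

Lemma pos_integer_sqr x : is_integer x -> x != 0 -> pos_integer (x ^+ 2).
Proof.
move=> Ix x0; split=> [|j]; first exact: is_integerX.
by rewrite rmorphXn lt_neqAle sqr_ge0 eq_sym sqrf_eq0 fmorph_eq0 x0.
Qed.

Definition sums_to (alpha : F) (s : seq F) :=
  (forall h, h \in s -> pos_integer h) /\ \sum_(h <- s) h = alpha.

Definition square_weight (s : seq F) : nat := (\sum_(h <- s) int_trace sigma (h ^+ 2))%N.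

Lemma sums_to_perm alpha s t : perm_eq s t -> sums_to alpha s -> sums_to alpha t.
Proof.
move=> st [ps es]; split; last by rewrite -(perm_big _ st).
by move=> h ht; apply: ps; rewrite (perm_mem st).
Qed.

Lemma sums_to_size alpha s : pos_integer alpha -> sums_to alpha s ->
  (size s <= int_trace sigma alpha)%N.
Proof.
move=> pa [ps es]; rewrite -(ler_nat R) (proj1 (pos_integer_trace pa)).
have -> : \sum_j sigma j alpha = \sum_(h <- s) \sum_j sigma j h.
  by rewrite exchange_big /=; apply: eq_bigr => j _; rewrite -es rmorph_sum.
rewrite -sum1_size natr_sum big_seq [X in _ <= X]big_seq; apply: ler_sum => h hs.
by have [<- t0] := pos_integer_trace (ps h hs); rewrite ler1n.
Qed.

Lemma sums_to_split alpha s h x : sums_to alpha s -> h \in s -> is_integer x -> x != 0 ->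
  (forall j, sigma j (x ^+ 2) < sigma j h) ->
  exists2 t, sums_to alpha t & size t = (size s).+1.
Proof.
move=> Hs hs Ix x0 lt; have [ps _] := Hs.
have [ps' es] := sums_to_perm (perm_to_rem hs) Hs.
exists [:: x ^+ 2, h - x ^+ 2 & rem h s]; last first.
  by have /perm_size := perm_to_rem hs; rewrite /= => ->.
split=> [g|]; last first.
  by rewrite !big_cons addrA [x ^+ 2 + _]addrC subrK; rewrite big_cons in es.
have [Ih _] := ps h hs.
rewrite !in_cons => /or3P[/eqP->|/eqP->|gs].
- exact: pos_integer_sqr.
- split=> [|j]; last by rewrite rmorphB subr_gt0.
  by apply: is_integerB => //; apply: is_integerX.
- by apply: ps'; rewrite in_cons gs orbT.
Qed.

(** (h + k) / 2 = k + (h - k) / 2 is an integer, and squaring is strictly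
    convex. *)
Lemma sums_to_merge alpha s h k : sums_to alpha s -> h \in s -> k \in s -> h != k ->
  is_integer ((h - k) / 2%:R) ->
  exists t, [/\ sums_to alpha t, size t = size s & (square_weight t < square_weight s)%N].
Proof.
move=> Hs hs ks hk Ihk.
have ks' : k \in rem h s.
  by move: ks; rewrite (perm_mem (perm_to_rem hs)) in_cons eq_sym (negPf hk).
have pr : perm_eq s [:: h, k & rem k (rem h s)].
  apply: perm_trans (perm_to_rem hs) _; rewrite perm_cons; exact: perm_to_rem.
have [ps es] := sums_to_perm pr Hs; set r := rem k _ in pr ps es.
have two0 : 2%:R != 0 :> F by rewrite natr_ext_eq0.
pose m := (h + k) / 2%:R.
have [[Ih ph] [Ik pk]] : pos_integer h /\ pos_integer k.
  by split; apply: ps; rewrite !in_cons eqxx ?orbT.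
have Em : m + m = h + k by rewrite /m; field; rewrite two0.
have sm j : sigma j m = (sigma j h + sigma j k) / 2%:R.
  by rewrite /m fmorph_div rmorphD rmorph_nat.
have Pm : pos_integer m.
  split=> [|j]; last by rewrite sm divr_gt0 ?addr_gt0.
  have -> : m = (h - k) / 2%:R + k by rewrite /m; field; rewrite two0.
  exact: is_integerD.
exists [:: m, m & r]; split.
- split=> [g|]; last by move: es; rewrite !big_cons !addrA Em.
  rewrite !in_cons => /or3P[/eqP->|/eqP->|gs] //.
  by apply: ps; rewrite !in_cons gs !orbT.
- by rewrite (perm_size pr).
rewrite /square_weight (perm_big _ pr) /= !big_cons !addnA ltn_add2r.
have Et x : pos_integer x -> (int_trace sigma (x ^+ 2))%:R = \sum_j sigma j x ^+ 2.
  move=> Px; have [-> _] := pos_integer_trace (pos_integer_sqr (proj1 Px)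
    (pos_integer_neq0 Px)).
  by apply: eq_bigr => j _; rewrite rmorphXn.
rewrite -(ltr_nat R) !natrD !Et // -!big_split /= -subr_gt0 -sumrB.
have pos j : 0 < sigma j h ^+ 2 + sigma j k ^+ 2 - (sigma j m ^+ 2 + sigma j m ^+ 2).
  have -> : sigma j h ^+ 2 + sigma j k ^+ 2 - (sigma j m ^+ 2 + sigma j m ^+ 2) =
      (sigma j h - sigma j k) ^+ 2 / 2%:R by rewrite sm; field.
  rewrite divr_gt0 // lt_neqAle sqr_ge0 eq_sym sqrf_eq0 subr_eq0 andbT.
  by rewrite (inj_eq (fmorph_inj _)).
by rewrite (bigD1 j0) //= ltr_wpDr // sumr_ge0 // => j _; apply: ltW.
Qed.

(** Maximize the number of summands, then minimize the total trace of their
    squares; both are natural numbers, the first one bounded by the trace of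
    alpha as every totally positive integer has trace at least 1. *)
Lemma decomposition alpha : pos_integer alpha ->
  exists s : seq F, [/\ sums_to alpha s,
    forall h, h \in s -> (N h)%:R < (n.+1 ^ n)%N%:R * Delta &
    (size (undup s) <= 2 ^ n)%N].
Proof.
move=> pa.
pose P k := `[< exists2 s, sums_to alpha s & size s = k >].
have exP : exists k, P k.
  exists 1%N; apply/asboolP; exists [:: alpha] => //; split=> [h|];
    last by rewrite big_seq1.
  by rewrite inE => /eqP->.
have maxP k : P k -> (k <= int_trace sigma alpha)%N.
  by move/asboolP=> [s Hs <-]; apply: sums_to_size.
case: (ex_maxnP exP maxP) => k /asboolP[s0 Hs0 ks0] kmax.
pose W w := `[< exists s, [/\ sums_to alpha s, size s = k & square_weight s = w] >].
have exW : exists w, W w by exists (square_weight s0); apply/asboolP; exists s0.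
case: (ex_minnP exW) => w /asboolP[s [Hs sk sw]] wmin.
exists s; split=> // [h hs|].
  rewrite ltNge; apply/negP=> big; have [Ih ph] := (proj1 Hs) h hs.
  have [x [Ix x0 lt]] := square_below sigma_inj bI Ih ph big.
  have [t Ht St] := sums_to_split Hs hs Ix x0 lt.
  have /kmax : P k.+1 by apply/asboolP; exists t; rewrite // St sk.
  by rewrite ltnn.
have [f Hf] := residue_classes bI (m := 2) isT.
have uf : uniq (map f (undup s)).
  rewrite map_inj_in_uniq ?undup_uniq // => g h; rewrite !mem_undup => gs hs E.
  apply/eqP; apply: contraT => gh.
  have Igh : is_integer ((g - h) / 2%:R).
    by apply: Hf => //; [apply: proj1 ((proj1 Hs) g gs)|apply: proj1 ((proj1 Hs) h hs)].
  have [t [Ht St lt]] := sums_to_merge Hs gs hs gh Igh.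
  have /wmin : W (square_weight t) by apply/asboolP; exists t; rewrite St.
  by rewrite leqNgt -sw lt.
rewrite -(size_map f) -(card_uniqP uf).
by apply: leq_trans (max_card _) _; rewrite card_ffun !card_ord.
Qed.

End Decomposition.

(** * The universal form *)

Section Form.
Variables (R : realType) (F : fieldExtType rat) (theta : F).
Let n := \dim {:F}.
Variable sigma : 'I_n -> {rmorphism F -> R}.
Hypothesis sigma_inj : injective (fun j => sigma j theta).
Hypothesis sigma_all : forall s : {rmorphism F -> R}, exists j, s =1 sigma j.
Variable b : n.-tuple F.
Hypothesis bI : integral_basis b.
Implicit Types x y h : F.
Local Notation N := (abs_norm sigma).
Local Notation Delta := (\det (embed_mx sigma b) ^+ 2).
Local Notation pos_integer := (pos_integer sigma).
Local Notation pos_unit := (pos_unit sigma).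
Local Notation square_equiv := (square_equiv sigma).

Lemma totally_positiveP x : totally_positive R x <-> forall j, 0 < sigma j x.
Proof.
split=> [px j|px s]; first exact: px.
by have [j ->] := sigma_all s.
Qed.

Lemma square_equiv_sym x y : square_equiv x y -> square_equiv y x.
Proof.
move=> [v pv ->]; exists v^-1; first exact: pos_unitV.
by rewrite -mulrA -exprMn mulfV ?expr1n ?mulr1 // (pos_unit_neq0 pv).
Qed.

(** A maximal family of pairwise inequivalent elements, which exists by
    [square_class_count]. *)
Lemma square_class_representatives (X : nat) : exists (m : nat) (x : 'I_m -> F),
  [/\ forall i, pos_integer (x i), (m <= 2 ^ n * #|tuples_le n X|)%N &
      forall h, pos_integer h -> (N h <= X)%N -> exists i, square_equiv h (x i)].
Proof.
pose good m := exists x : 'I_m -> F, (forall i, pos_integer (x i) /\ (N (x i) <= X)%N) /\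
  (forall i j, i != j -> ~ square_equiv (x i) (x j)).
have bound m : `[< good m >] -> (m <= 2 ^ n * #|tuples_le n X|)%N.
  move/asboolP=> [x [Hx nsq]]; apply: (square_class_count sigma_inj bI _ nsq) => i.
  by have [[Ix px] NX] := Hx i.
have good0 : exists m, `[< good m >].
  by exists 0%N; apply/asboolP; exists (fun=> 0); split; case.
case: (ex_maxnP good0 bound) => m gm mmax; have mb := bound m gm.
move/asboolP: gm => [x [Hx nsq]].
exists m, x; split=> // [i|h ph NX]; first by have [] := Hx i.
apply: contrapT => H; suff /mmax : `[< good m.+1 >] by rewrite ltnn.
apply/asboolP; exists (fun i => if unlift ord0 i is Some j then x j else h); split.
  by move=> i; case: unliftP => [j|] _; [exact: Hx|].
move=> i j; case: unliftP => [i' ->|->]; case: unliftP => [j' ->|->].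
- by rewrite (inj_eq lift_inj) => ij; apply: nsq.
- by move=> _ sq; apply: H; exists i'; apply: square_equiv_sym.
- by move=> _ sq; apply: H; exists j'.
- by rewrite eqxx.
Qed.

Lemma quadratic_form_diag (r : nat) (d v : 'rV[F]_r) :
  quadratic_form (diag_mx d) v = \sum_(i < r) d 0 i * v 0 i ^+ 2.
Proof.
apply: eq_bigr => i _; rewrite (bigD1 i) //= big1 ?addr0 => [|j /andP[_ /negPf ji]].
  by rewrite mxE eqxx mulr1n expr2 mulrA.
by rewrite mxE eq_sym ji mulr0n !mul0r.
Qed.

Lemma diag_totally_positive_definite (r : nat) (d : 'rV[F]_r) :
  (forall i, pos_integer (d 0 i)) -> totally_positive_definite R (diag_mx d).
Proof.
move=> dpos v v0; apply/totally_positiveP => j; rewrite quadratic_form_diag rmorph_sum.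
have term_ge0 i : 0 <= sigma j (d 0 i * v 0 i ^+ 2).
  by rewrite rmorphM rmorphXn mulr_ge0 ?sqr_ge0 // ltW //; have [] := dpos i.
have [k vk] : exists k, v 0 k != 0.
  apply/existsP; move: v0; apply: contraR; rewrite negb_exists => /forallP H.
  by apply/eqP/rowP=> i; rewrite mxE; apply/eqP; rewrite -[_ == _]negbK.
rewrite (bigD1 k) //= ltr_wpDr ?sumr_ge0 //.
rewrite rmorphM rmorphXn mulr_gt0 //; first by have [] := dpos k.
by rewrite lt_neqAle sqr_ge0 eq_sym sqrf_eq0 fmorph_eq0 vk.
Qed.

(** The index (i, t, l) stands for the l-th of four squares in the t-th slot of
    the coefficient rep i, with one slot for each possible distinct summand of
    [decomposition]. Different summands may have the same representative, which
    is why every coefficient needs all the slots. *)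
Lemma universal_form_of_representatives (m : nat) (rep : 'I_m -> F) :
  (forall i, pos_integer (rep i)) ->
  (forall h, pos_integer h -> (N h)%:R < (n.+1 ^ n)%N%:R * Delta ->
     exists i, square_equiv h (rep i)) ->
  exists a : 'M[F]_#|{: 'I_m * 'I_(2 ^ n) * 'I_4}|, universal_form R a.
Proof.
move=> rep_pos cover; pose I := ('I_m * 'I_(2 ^ n) * 'I_4)%type.
pose d : 'rV[F]_#|{: I}| := \row_k rep (enum_val k).1.1.
have dpos i : pos_integer (d 0 i) by rewrite mxE.
exists (diag_mx d); split.
- move=> i j _; rewrite mxE; case: eqP => _ /=; last by rewrite mulr0n; apply: is_integer0.
  by rewrite mulr1n; have [] := dpos i.
- exact: diag_totally_positive_definite.
move=> alpha Ia /totally_positiveP pa.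
have [s [[ps es] Ns us]] := decomposition sigma_inj bI (conj Ia pa).
set u := undup s in us.
have [h0 h0s] : exists h, h \in s.
  case: (s) es => [|h t _]; last by exists h; apply: mem_head.
  by rewrite big_nil => a0; have := sigma_gt0_neq0 pa; rewrite -a0 eqxx.
have [i0 _] := cover _ (ps _ h0s) (Ns _ h0s).
have Hh (t : 'I_(2 ^ n)) : exists iv : 'I_m * F, (t < size u)%N ->
    pos_unit iv.2 /\ u`_t = rep iv.1 * iv.2 ^+ 2.
  case: (boolP (t < size u)%N) => [tu|_].
    have ut : u`_t \in s by rewrite -mem_undup mem_nth.
    by have [i [v pv E]] := cover _ (ps _ ut) (Ns _ ut); exists (i, v).
  by exists (i0, 0).
have [iv Hiv] := choice Hh.
have Hn (t : 'I_(2 ^ n)) : exists c : 'I_4 -> int, (count_mem u`_t s)%:Z = \sum_l c l ^+ 2.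
  have [c0 [c1 [c2 [c3 E]]]] := sum4sq_nat (count_mem u`_t s).
  exists (fun l => [:: c0; c1; c2; c3]`_l).
  by rewrite E !big_ord_recl big_ord0 /= addr0 !addrA.
have [c Hc] := choice Hn.
pose v (k : I) : F := if (k.1.2 < size u)%N && (k.1.1 == (iv k.1.2).1)
  then (iv k.1.2).2 * (c k.1.2 k.2)%:~R else 0.
exists (\row_k v (enum_val k)).
  move=> k; rewrite mxE /v; case: ifP => [/andP[lt _]|_]; last exact: is_integer0.
  apply: is_integerM; last exact: is_integer_int.
  by have [[]] := Hiv _ lt.
rewrite quadratic_form_diag.
have -> : \sum_(k < #|{: I}|) d 0 k * (\row_k0 v (enum_val k0)) 0 k ^+ 2 =
    \sum_(k : I) rep k.1.1 * v k ^+ 2.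
  rewrite [RHS](reindex (@enum_val I predT)) /=; last first.
    by apply: onW_bij; apply: enum_val_bij.
  by apply: eq_bigr => k _; rewrite !mxE.
have slot (t : 'I_(2 ^ n)) : \sum_i \sum_l rep i * v (i, t, l) ^+ 2 =
    if (t < size u)%N then u`_t *+ count_mem u`_t s else 0.
  case: ifP => tu; last first.
    by rewrite big1 // => i _; rewrite big1 // => l _; rewrite /v /= tu expr0n mulr0.
  have [_ Eu] := Hiv t tu.
  rewrite (bigD1 (iv t).1) //= [X in _ + X]big1 ?addr0 => [|i /negPf it]; last first.
    by rewrite big1 // => l _; rewrite /v /= tu it expr0n mulr0.
  rewrite -mulr_natr pmulrn (Hc t) rmorph_sum mulr_sumr.
  apply: eq_bigr => l _; rewrite /v /= tu eqxx /= exprMn rmorphXn /= Eu mulrA //.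
rewrite (eq_bigr (fun k => rep k.1.1 * v (k.1.1, k.1.2, k.2) ^+ 2)) => [|[[i t] l] _] //.
rewrite -(pair_bigA _ (fun p l => rep p.1 * v (p.1, p.2, l) ^+ 2)) /=.
rewrite -(pair_bigA _ (fun i t => \sum_l rep i * v (i, t, l) ^+ 2)) /= exchange_big /=.
rewrite (eq_bigr _ (fun t _ => slot t)) -big_mkcond /=.
rewrite -(big_ord_widen _ (fun t => u`_t *+ count_mem u`_t s)) // -[RHS]es.
rewrite -[RHS](big_undup_iterop_count _ s xpredT id) (big_nth 0) big_mkord.
apply: eq_bigr => t _; set x := u`_t.
by case: (count_mem x s) => // k; rewrite Monoid.iteropE iteropS mulrS.
Qed.
End Form.

(** Since ln D >= ln 2 when e > 0, the terms 1 and ln c are at most constant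
    multiples of ln D. *)
Lemma log_power_bound (R : realType) (c D e : nat) : (0 < c)%N -> (0 < D)%N ->
  ((0 < e)%N -> (1 < D)%N) ->
  (1 + ln (c * D)%N%:R) ^+ e <= (1 + (1 + ln c%:R) / ln 2) ^+ e * ln (D%:R : R) ^+ e /\
  0 < ln (D%:R : R) ^+ e.
Proof.
move=> c0 D0; case: e => [|e] /= D1; first by rewrite !expr0 mulr1 ltr01 lexx.
have {}D1 := D1 isT.
have l2 : 0 < ln (2 : R) by rewrite ln_gt0 // ltr1n.
have lD : ln 2 <= ln (D%:R : R) by rewrite ler_ln ?posrE ?ltr0n // ler_nat.
have lD0 := lt_le_trans l2 lD.
have lc : 0 <= ln (c%:R : R) by rewrite ln_ge0 // ler1n.
split; last exact: exprn_gt0.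
have K0 : 0 <= (1 + ln c%:R) / ln 2 :> R by rewrite divr_ge0 ?addr_ge0 // ltW.
rewrite -exprMn natrM lnM ?posrE ?ltr0n //.
apply: lerXn2r; rewrite ?nnegrE ?addr_ge0 ?mulr_ge0 ?addr_ge0 ?(ltW lD0) //.
rewrite addrA mulrDl mul1r [leRHS]addrC lerD2r mulrAC ler_pdivlMr //.
by rewrite ler_wpM2l // addr_ge0.
Qed.

Theorem theorem1 (R : realType) (d : nat) (d_gt0 : (0 < d)%N) :
  exists2 C : R, 0 < C &
    forall (F : fieldExtType rat) (Delta : int),
      totally_real R F -> \dim {:F} = d -> is_discriminant F Delta ->
      exists (r : nat) (a : 'M[F]_r),
        universal_form R a /\
        r%:R < C * Delta%:~R * ln (Delta%:~R : R) ^+ d.-1.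
Proof.
pose c := (d.+1 ^ d)%N.
pose K : R := 1 + (1 + ln c%:R) / ln 2.
have c0 : (0 < c)%N by rewrite expn_gt0.
have l2 : 0 < ln (2 : R) by rewrite ln_gt0 // ltr1n.
have K0 : 0 <= K.
  by rewrite addr_ge0 // divr_ge0 ?(ltW l2) // addr_ge0 // ln_ge0 // ler1n.
pose M : R := (4 ^ d.+1 * c)%N%:R * K ^+ d.-1.
have M0 : 0 <= M by rewrite mulr_ge0 ?ler0n ?exprn_ge0.
exists (M + 1); first by rewrite ltr_wpDl.
move=> F Delta totr Ed [b bI detE].
have [theta [sigma [_ sigma_inj sigma_all]]] := real_embeddings totr.
have DE := disc_embed sigma_inj detE.
have D0 : 0 < Delta%:~R :> R by rewrite DE; exact: (det_embed_sqr_gt0 sigma_inj bI).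
have [D Delta_eq] : exists D : nat, Delta = D%:Z.
  by exists `|Delta|%N; move: D0; rewrite ltr0z; lia.
rewrite {}Delta_eq in DE D0 detE *; rewrite ltr0z in D0.
have {}D0 : (0 < D)%N by [].
have D1 : (0 < d.-1)%N -> (1 < D)%N.
  move=> d1; have : \det (embed_mx sigma b) ^+ 2 != 1.
    by apply: (disc_neq1 sigma_inj bI); rewrite Ed; lia.
  by rewrite -DE -[1]/(1%:R) eqr_nat; lia.
have [pow_le lnD0] := log_power_bound R c0 D0 D1.
pose X := (c * D)%N.
have X0 : (0 < X)%N by rewrite muln_gt0 c0.
have [m [rep [rep_pos m_le cover]]] := square_class_representatives sigma_inj bI X.
have [|a Ha] := universal_form_of_representatives sigma_inj sigma_all bI rep_pos.
  move=> h ph; rewrite -DE Ed -natrM ltr_nat => /ltnW; exact: cover.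
eexists; exists a; split=> //.
rewrite !card_prod !card_ord.
apply: (@le_lt_trans _ _ (M * D%:R * ln D%:R ^+ d.-1)); last first.
  by rewrite -[X in X < _]mulrA -[X in _ < X]mulrA ltr_pM2r ?ltrDl // mulr_gt0 // ltr0n.
apply: (@le_trans _ _ ((4 ^ d.+1)%N%:R * (X%:R * (1 + ln X%:R) ^+ d.-1))); last first.
  rewrite /M /X !natrM -!mulrA ler_wpM2l ?ler0n // ler_wpM2l ?ler0n //.
  rewrite [leRHS]mulrCA ler_wpM2l ?ler0n //.
  by rewrite -natrM.
apply: (@le_trans _ _ ((4 ^ d.+1)%N%:R * (#|tuples_le d X|)%:R)).
  rewrite -natrM ler_nat Ed; rewrite Ed in m_le.
  have -> : (4 ^ d.+1 = 2 ^ d * 2 ^ d * 4)%N by rewrite expnSr -expnMn.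
  rewrite [X in (_ <= X)%N]mulnAC leq_mul2r /= [X in (_ <= X)%N]mulnAC leq_mul2r.
  by rewrite m_le orbT.
by rewrite ler_wpM2l ?ler0n // card_tuples_le.
Qed.
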